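(* Let $P$ be an $n$-dimensional lattice polytope in $\mathbb{R}^n$ of degree $d$. Then $P$ decomposes as a Cayley sum of lattice polytopes in $\mathbb{R}^q$ for some $q \leq (d^2 + 19d - 4)/2$.
   Context: A lattice polytope is the convex hull of finitely many lattice points. For an $n$-dimensional lattice polytope $P\subset\mathbb{R}^n$, write $\sum_{m\ge0}|mP\cap\mathbb{Z}^n|t^m = h^*_P(t)/(1-t)^{n+1}$ with $h^*_P$ a polynomial; the degree $d$ of $P$ is the degree of $h^*_P$. Equivalently, $d$ is the largest nonnegative integer such that $(n-d)P$ has no lattice points in its (relative) interior. If $P_0,\dots,P_s$ are lattice polytopes in $\mathbb{R}^q$, their Cayley sum $P_0*\cdots*P_s$ is the convex hull of $(P_0\times 0)\cup(P_1\times e_1)\cup\cdots\cup(P_s\times e_s)$ in $\mathbb{R}^q\times\mathbb{R}^s$, where $e_1,\dots,e_s$ is the standard basis of $\mathbb{R}^s$. $P$ decomposes as a Cayley sum of lattice polytopes in $\mathbb{R}^q$ if there is an affine isomorphism $\mathbb{R}^n\cong\mathbb{R}^q\times\mathbb{R}^s$ mapping $\mathbb{Z}^n$ onto $\mathbb{Z}^q\times\mathbb{Z}^s$ and identifying $P$ with $P_0*\cdots*P_s$ for some lattice polytopes $P_0,\dots,P_s\subset\mathbb{R}^q$.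
   Formalization: The degree d is assumed to be at least 1; for d = 0 (for example the standard unimodular simplex) the stated bound would be q ≤ −2, which no q satisfies. *)

(* Defs.v *)
From HB Require Import structures.
From mathcomp Require Import all_boot all_order all_algebra.
From mathcomp Require Import reals.
Set Implicit Arguments. Unset Strict Implicit. Unset Printing Implicit Defensive.
Import Order.TTheory GRing.Theory Num.Theory.
Local Open Scope ring_scope.

Section Defs.
Variable R : realType.

Definition lattice_pt (n : nat) (x : 'rV[R]_n) : Prop :=
  forall i, x ord0 i \is a Num.int.

Definition conv (n : nat) (A : 'rV[R]_n -> Prop) (x : 'rV[R]_n) : Prop :=
  exists (k : nat) (p : 'I_k -> 'rV[R]_n) (w : 'I_k -> R),
    [/\ forall i, A (p i), forall i, 0 <= w i, \sum_(i < k) w i = 1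
      & x = \sum_(i < k) w i *: p i].

Definition is_lattice_list (n : nat) (V : seq 'rV[R]_n) : Prop :=
  V != [::] /\ forall v, v \in V -> lattice_pt v.

Definition polytope (n : nat) (V : seq 'rV[R]_n) : 'rV[R]_n -> Prop :=
  conv (fun x => x \in V).

Definition full_dim (n : nat) (V : seq 'rV[R]_n) : Prop :=
  \rank (\matrix_(i < size V) (V`_i - V`_0)) = n.

Definition dilate (n : nat) (m : nat) (P : 'rV[R]_n -> Prop) (x : 'rV[R]_n) :=
  exists2 y, P y & x = m%:R *: y.

Definition lattice_count (n : nat) (A : 'rV[R]_n -> Prop) (N : nat) : Prop :=
  exists s : seq 'rV[R]_n, [/\ uniq s,
    forall z, z \in s <-> (lattice_pt z /\ A z) & size s = N].

(* coefficient of t^k in (1-t)^(n+1) * sum_m L(m) t^m *)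
Definition hstar_coef (n : nat) (L : nat -> nat) (k : nat) : int :=
  \sum_(i < k.+1) (-1) ^+ i * ('C(n.+1, i))%:Z * (L (k - i)%N)%:Z.

Definition has_degree (n : nat) (P : 'rV[R]_n -> Prop) (d : nat) : Prop :=
  exists L : nat -> nat,
    [/\ forall m, lattice_count (dilate m P) (L m),
        hstar_coef n L d != 0
      & forall k, (d < k)%N -> hstar_coef n L k = 0].

(* e_0 := 0, e_i := i-th standard basis vector of R^s for 1 <= i <= s *)
Definition cay_e (s : nat) (i : 'I_s.+1) : 'rV[R]_s :=
  \row_(j < s) (if (j.+1 == i :> nat) then 1 else 0).

Definition cayley_sum (q s : nat) (Ps : 'I_s.+1 -> 'rV[R]_q -> Prop)
  : 'rV[R]_(q + s) -> Prop :=
  conv (fun z => exists i, exists2 x, Ps i x & z = row_mx x (cay_e i)).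

Definition cayley_decomposes (n q : nat) (P : 'rV[R]_n -> Prop) : Prop :=
  exists (s : nat) (A : 'M[R]_(n, q + s)) (b : 'rV[R]_(q + s))
         (Vs : 'I_s.+1 -> seq 'rV[R]_q),
    let f := fun x : 'rV[R]_n => x *m A + b in
    [/\ bijective f,
        forall x, lattice_pt x <-> lattice_pt (f x),
        forall i, is_lattice_list (Vs i)
      & forall y, (exists2 x, P x & f x = y) <->
                  cayley_sum (fun i => polytope (Vs i)) y].

End Defs.

(* Main.v *)
(* Work in the cone over P x 1, of dimension N = n + 1, graded by height.

   Reciprocity: a generic cost vector w selects, for each generic point of the
   cone, a unique optimal basis among the vertices, which triangulates the cone;
   moving points slightly in a generic direction y splits the lattice points of
   the cone into half-open simplicial cones.  Hence h*_j counts the lattice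
   points of height j in half-open boxes, and the complement of the box part of
   an interior point z is such a point of height at least N - height z.  So
   every interior lattice point has height at least N - d.

   Choose N vertices v_i of maximal determinant, so that the coordinates of all
   vertices in the basis (v_i) lie in [-1,1].  Box points of this simplex are
   supported on at most 2d of the v_i; averaging over all box points, fewer than
   4d coordinates fail to be integral on the lattice.  Let U contain these.  As
   long as a vertex w has a negative coordinate outside U, or its coordinates
   outside U sum to more than 1, use w to build interior lattice points of
   smaller height: enlarging U by at most 3f elements lowers the height by
   f >= 1.  The total gain is at most d, so U ends with fewer than 7d elements.
   Then the coordinates outside U map every vertex to a vertex of a unimodular
   simplex, which is a Cayley decomposition with q = |U| - 1 (after putting one
   element into U to make it nonempty). *)

Require Import Defs.
From HB Require Import structures.
From mathcomp Require Import all_boot all_order all_algebra.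
From mathcomp Require Import reals.
From mathcomp Require Import boolp ring lra zify.
Set Implicit Arguments. Unset Strict Implicit. Unset Printing Implicit Defensive.
Import Order.TTheory GRing.Theory Num.Theory.
Local Open Scope ring_scope.

(** * Linear programming over the rows of a matrix *)

Section SimplexMethod.
Variables (R : realFieldType) (k N : nat) (A : 'M[R]_(k, N)).

(* The rows of A indexed by S form a basis, and the columns of B are its dual
   functionals: x *m B lists the coordinates of x, extended by zero off S. *)
Definition coord_basis (S : {set 'I_k}) (B : 'M[R]_(N, k)) : Prop :=
  [/\ B *m A = 1%:M, forall i j, j \notin S -> B i j = 0
    & forall i, i \in S -> row i A *m B = delta_mx 0 i].

Lemma coord_basis_notin S B (x : 'rV_N) j :
  coord_basis S B -> j \notin S -> (x *m B) 0 j = 0.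
Proof. by case=> _ B0 _ jS; rewrite mxE big1 // => i _; rewrite B0 ?mulr0. Qed.

(** [B *m A *m B'] is [B'] because [B *m A] is the identity, and is [B] because [B] vanishes off [S]
    while the rows of [A *m B'] over [S] are unit vectors. *)
Lemma coord_basis_uniq S B B' : coord_basis S B -> coord_basis S B' -> B = B'.
Proof.
move=> [BA B0 BS] [B'A _ B'S].
rewrite -[RHS]mul1mx -BA -mulmxA.
apply/matrixP=> i j; rewrite mxE (bigD1_ord j) //=.
have row_AB' l : l \in S -> forall m, (A *m B') l m = (l == m)%:R.
  move=> lS m; have := B'S _ lS; rewrite -row_mul => /rowP/(_ m).
  by rewrite !mxE eqxx eq_sym.
have term l : B i l * (A *m B') l j = if l == j then B i j else 0.
  have [lS|lS] := boolP (l \in S).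
    by rewrite row_AB' //; case: eqP => [->|]; rewrite ?mulr1 ?mulr0.
  by rewrite B0 // mul0r; case: eqP => // <-; rewrite B0.
rewrite term eqxx big1 ?addr0 // => l _.
by rewrite term eq_sym (negPf (neq_lift _ _)).
Qed.

Lemma coord_basisK S B (x : 'rV_N) : coord_basis S B -> x *m B *m A = x.
Proof. by case=> BA _ _; rewrite -mulmxA BA mulmx1. Qed.

(** Both numbers are traces: [B *m A] is the identity, and the diagonal of [A *m B] is the indicator
    of [S]. *)
Lemma coord_basis_card S B : coord_basis S B -> #|S| = N.
Proof.
move=> [BA B0 BS]; apply/eqP; rewrite -(eqr_nat R).
rewrite -(mxtrace_scalar N (1 : R)) -BA mxtrace_mulC /mxtrace.
rewrite (bigID (mem S)) /= [X in _ + X]big1 ?addr0.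
  rewrite (eq_bigr (fun=> 1)) ?sumr_const // => i iS.
  by have := BS _ iS; rewrite -row_mul => /rowP/(_ i); rewrite !mxE !eqxx.
by move=> i iS; rewrite mxE big1 // => l _; rewrite B0 ?mulr0.
Qed.

Section Pivot.
Variables (S : {set 'I_k}) (B : 'M[R]_(N, k)) (j r : 'I_k).
Hypothesis SB : coord_basis S B.
Let c := row j A *m B.
Hypothesis cr0 : c 0 r != 0.

(** Rank-one update for the exchange in which row [j] enters and row [r] leaves. *)
Definition pivot : 'M[R]_(N, k) :=
  B + (c 0 r)^-1 *: (col r B *m (delta_mx 0 j - c)).

Lemma pivotE (x : 'rV_N) l :
  (x *m pivot) 0 l =
  (x *m B) 0 l + (x *m B) 0 r / c 0 r * ((l == j)%:R - c 0 l).
Proof.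
rewrite /pivot mulmxDr -scalemxAr mulmxA colE mulmxA -colE [LHS]mxE; congr (_ + _).
by rewrite mxE [X in _ * X]mxE big_ord1 !mxE eqxx /=; ring.
Qed.

Lemma pivot_cost (x : 'rV_N) (w : 'cV_k) :
  (x *m pivot *m w) 0 0 =
  (x *m B *m w) 0 0 + (x *m B) 0 r / c 0 r * (w j 0 - (c *m w) 0 0).
Proof.
have -> : x *m pivot =
    x *m B + ((x *m B) 0 r / c 0 r) *: (delta_mx 0 j - c).
  by apply/rowP => l; rewrite pivotE [RHS]mxE [X in _ = _ + X]mxE
    [X in _ = _ + _ * X]mxE [delta_mx _ _ _ _]mxE [(- c) _ _]mxE !eqxx.
rewrite mulmxDl -scalemxAl mulmxBl -rowE [LHS]mxE [X in _ + X = _]mxE.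
by rewrite [X in _ * X]mxE [row _ _ _ _]mxE [(- (c *m w)) _ _]mxE.
Qed.

Lemma pivot_basis : coord_basis (j |: (S :\ r)) pivot.
Proof.
have [BA B0 BS] := SB; split.
- rewrite mulmxDl BA -scalemxAl -mulmxA mulmxBl -rowE -mulmxA BA mulmx1.
  by rewrite subrr mulmx0 scaler0 addr0.
- move=> i l; rewrite !inE negb_or negb_and negbK => /andP[lj lS].
  have -> : pivot i l = (row i pivot) 0 l by rewrite [RHS]mxE.
  rewrite rowE pivotE (negPf lj) sub0r.
  have [lr|lr] := eqVneq l r.
    by rewrite lr mulrN mulfVK ?subrr.
  rewrite (negPf lr) /= in lS.
  by rewrite !(coord_basis_notin _ SB lS) oppr0 mulr0 addr0.
- move=> i; rewrite !inE => /orP[/eqP->|/andP[ir iS]]; apply/rowP=> l.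
    rewrite pivotE -/c divff // mul1r [RHS]mxE eqxx /=; ring.
  rewrite pivotE BS // [X in _ + X / _ * _]mxE eq_sym (negPf ir) /=.
  by rewrite mul0r mul0r addr0.
Qed.
End Pivot.

Lemma cone_add S B (x : 'rV_N) (mu : R) (j : 'I_k) :
  coord_basis S B -> (forall i, 0 <= (x *m B) 0 i) -> 0 <= mu ->
  exists S' B', coord_basis S' B' /\
    forall i, 0 <= ((x + mu *: row j A) *m B') 0 i.
Proof.
move=> SB xB mu0; have [BA B0 BS] := SB.
have coE i : ((x + mu *: row j A) *m B) 0 i =
    (x *m B) 0 i + mu * (row j A *m B) 0 i.
  by rewrite mulmxDl -scalemxAl mxE [X in _ + X]mxE.
have [jS|jS] := boolP (j \in S).
  exists S, B; split=> // i.
  by rewrite coE addr_ge0 // mulr_ge0 // BS // mxE ler0n.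
set c := row j A *m B in coE *; set l := x *m B in xB coE *.
have [/forallP all0|/forallPn[r0 r0n]] :=
    boolP [forall i, 0 <= l 0 i + mu * c 0 i].
  by exists S, B; split=> // i; rewrite coE.
rewrite -ltNge in r0n.
have c_r0 : c 0 r0 < 0.
  rewrite ltNge; apply/negP => c0; have := xB r0.
  by have := mulr_ge0 mu0 c0; lra.
(* The ratios are nonpositive; the largest belongs to a coordinate that vanishes first along
   [x + t *: row j A]. The failure at [r0] puts this [t] at or below [mu]. *)
case: (@Order.TotalTheory.arg_maxP _ _ _ r0 (fun i => c 0 i < 0)
  (fun i => l 0 i / c 0 i) c_r0) => r cr maxr.
have rS : r \in S.
  apply: contraTT cr => rS; rewrite -leNgt.
  by rewrite /c (coord_basis_notin _ SB rS).
have br : l 0 r / c 0 r + mu >= 0.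
  have h1 : l 0 r0 + mu * c 0 r0 <= 0 by lra.
  have h2 := maxr _ c_r0.
  have h3 : 0 <= l 0 r0 / c 0 r0 + mu.
    have -> : l 0 r0 / c 0 r0 + mu = (l 0 r0 + mu * c 0 r0) / c 0 r0.
      by rewrite mulrDl mulfK ?lt_eqF.
    by rewrite -mulrNN -invrN mulr_ge0 ?invr_ge0 ?oppr_ge0 // ltW.
  exact: le_trans h3 (lerD h2 (lexx _)).
have cr0 : c 0 r != 0 by rewrite lt_eqF.
exists (j |: (S :\ r)), (pivot B j r); split; first exact: pivot_basis.
move=> i; rewrite pivotE -/c coE coE.
have -> : (l 0 r + mu * c 0 r) / c 0 r = l 0 r / c 0 r + mu.
  by rewrite mulrDl mulfK.
have [->|ij] := eqVneq i j.
  have -> : l 0 j = 0 by exact: coord_basis_notin SB jS.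
  have -> : c 0 j = 0 by exact: coord_basis_notin SB jS.
  by rewrite /=; move: br; set q := l 0 r / c 0 r; lra.
rewrite /= sub0r.
suff : l 0 r / c 0 r * c 0 i <= l 0 i.
  by set q := l 0 r / c 0 r; move=> h; nra.
have [ci|ci] := ltP (c 0 i) 0.
  rewrite -[leRHS](divfK (ltr0_neq0 ci)) ler_nM2r //; exact: maxr.
apply: le_trans (xB i); rewrite -mulrA mulr_ge0_le0 //.
by rewrite mulr_le0_ge0 // invr_le0 ltW.
Qed.

(** Caratheodory's theorem for cones, by adding the generators one at a time. *)
Lemma cone_basis S0 B0 (mu : 'rV_k) :
  coord_basis S0 B0 -> (forall i, 0 <= mu 0 i) ->
  exists S B, coord_basis S B /\ forall i, 0 <= (mu *m A *m B) 0 i.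
Proof.
move=> SB0 mu0; rewrite mulmx_sum_row.
elim: (index_enum _) => [|j s [S [B [SB xB]]]].
  by exists S0, B0; split=> // i; rewrite big_nil mul0mx mxE.
by rewrite big_cons addrC; exact: cone_add SB xB (mu0 j).
Qed.

Hypothesis (h : 'cV[R]_N) (Ah : A *m h = const_mx 1).
Variable w : 'cV[R]_k.

(** For a basis [S], the functional [B *m w] agrees with [w] on the rows in [S]; it must lie
    strictly below [w] on all other rows. *)
Definition dual_feasible (S : {set 'I_k}) (B : 'M[R]_(N, k)) : Prop :=
  forall j, j \notin S -> (row j A *m B *m w) 0 0 < w j 0.

(** Expanding [x] in one basis shows that its cost through the other is no larger, with equality
    only if the first support lies in the second. By symmetry costs and supports agree. *)
Lemma dual_feasible_uniq S B S' B' (x : 'rV_N) :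
  coord_basis S B -> coord_basis S' B' ->
  dual_feasible S B -> dual_feasible S' B' ->
  (forall i, i \in S -> 0 < (x *m B) 0 i) ->
  (forall i, i \in S' -> 0 < (x *m B') 0 i) -> S = S'.
Proof.
have half T C T' C' : coord_basis T C -> coord_basis T' C' ->
  dual_feasible T C -> (forall i, i \in T' -> 0 < (x *m C') 0 i) ->
  (x *m C *m w) 0 0 <= (x *m C' *m w) 0 0
     ?= iff (T' \subset T).
  move=> TC TC' dT x'.
  have xE : x = \sum_i (x *m C') 0 i *: row i A.
    by rewrite -mulmx_sum_row (coord_basisK _ TC').
  rewrite [X in X *m C]xE !mulmx_suml summxE [X in _ <= X ?= iff _]mxE.
  have -> : (T' \subset T) = [forall (i | true), (i \in T') ==> (i \in T)].
    apply/subsetP/forallP=> H i; first by apply/implyP=> _; apply/implyP/H.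
    exact/implyP/(implyP (H i)).
  apply: leif_sum => i _.
  rewrite -!scalemxAl [X in X <= _ ?= iff _]mxE.
  have [iT'|iT'] := boolP (i \in T'); last first.
    by rewrite (coord_basis_notin _ TC' iT') !mul0r; apply/leif_refl.
  have [iT|iT] := boolP (i \in T).
    have [_ _ ->] := TC => //.
    rewrite -rowE [row i w 0 0]mxE.
    exact/leif_refl.
  by split; [|apply/negbTE; rewrite lt_eqF //]; rewrite ?ler_pM2l ?ltr_pM2l ?x' ?ltW ?dT.
move=> SB SB' dS dS' xS xS'.
have [l1 e1] := half _ _ _ _ SB SB' dS xS'.
have [l2 e2] := half _ _ _ _ SB' SB dS' xS.
have E : (x *m B *m w) 0 0 = (x *m B' *m w) 0 0 by apply/le_anti; rewrite l1 l2.
by apply/eqP; rewrite eqEsubset -e1 -e2 E eqxx.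
Qed.

(** A choice depending on [S] alone, so that minima range over finitely many sets; 0 is the default
    when [S] carries no basis. *)
Definition basis_mx (S : {set 'I_k}) : 'M[R]_(N, k) :=
  if pselect (exists B, coord_basis S B) is left SB then projT1 (cid SB) else 0.

Lemma basis_mxP S B : coord_basis S B -> basis_mx S = B.
Proof.
move=> SB; rewrite /basis_mx; case: pselect => [e|[]]; last by exists B.
by case: cid => /= B' /coord_basis_uniq; exact.
Qed.

(** A cheapest basis with nonnegative coordinates works, since a violating row could enter and lower
    the cost; genericity makes the inequalities strict. *)
Lemma dual_feasible_exists S0 B0 (x : 'rV_N) :
  (forall S B j, coord_basis S B -> j \notin S ->
     (row j A *m B *m w) 0 0 != w j 0) ->
  (forall S B i, coord_basis S B -> i \in S -> (x *m B) 0 i != 0) ->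
  coord_basis S0 B0 -> (forall i, 0 <= (x *m B0) 0 i) ->
  exists S, [/\ coord_basis S (basis_mx S), dual_feasible S (basis_mx S)
    & forall i, i \in S -> 0 < (x *m basis_mx S) 0 i].
Proof.
move=> genw genx SB0 x0.
pose feas S := `[< coord_basis S (basis_mx S) >] &&
  [forall i, 0 <= (x *m basis_mx S) 0 i].
have feas0 : feas S0.
  rewrite /feas (basis_mxP SB0); apply/andP; split; first exact/asboolP.
  exact/forallP.
case: (@Order.TotalTheory.arg_minP _ _ _ S0 feas
  (fun S => (x *m basis_mx S *m w) 0 0) feas0) => S /andP[/asboolP SB xS] minS.
move/forallP in xS; set B := basis_mx S in SB xS minS.
have xS' i : i \in S -> 0 < (x *m B) 0 i.
  by move=> iS; rewrite lt_def xS (genx _ _ _ SB iS).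
exists S; split=> //; rewrite -/B => j jS.
rewrite lt_neqAle (genw _ _ _ SB jS) /= leNgt; apply/negP => wj.
set c := row j A *m B in wj.
(* The coordinates of row [j] add up to its height 1, so one of them is positive and the ratio test
   finds a leaving row. *)
have [r0 cr0] : exists r, 0 < c 0 r.
  apply/existsP; apply: contraTT isT => /existsPn c0.
  have : (row j A *m h) 0 0 = 1 by rewrite -row_mul Ah !mxE.
  rewrite -[row j A](coord_basisK _ SB) -mulmxA Ah mxE.
  move=> s1; have : \sum_i c 0 i * (const_mx 1 : 'cV[R]_k) i 0 <= 0.
    by apply: sumr_le0 => i _; rewrite [const_mx _ _ _]mxE mulr1 leNgt.
  by rewrite s1 ler10.
case: (@Order.TotalTheory.arg_minP _ _ _ r0 (fun i => 0 < c 0 i)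
  (fun i => (x *m B) 0 i / c 0 i) cr0) => r cr minr.
have rS : r \in S.
  apply: contraTT cr => rS; rewrite -leNgt.
  by rewrite /c (coord_basis_notin _ SB rS).
have br := divr_gt0 (xS' _ rS) cr.
have pB := pivot_basis SB (lt0r_neq0 cr).
have /minS : feas (j |: (S :\ r)).
  rewrite /feas (basis_mxP pB); apply/andP; split; first exact/asboolP.
  apply/forallP => i; rewrite pivotE -/c.
  have [->|ij] := eqVneq i j.
    have -> : (x *m B) 0 j = 0 by exact: coord_basis_notin SB jS.
    have -> : c 0 j = 0 by exact: coord_basis_notin SB jS.
    by rewrite /=; move: br; set q := _ / c 0 r; lra.
  rewrite /= sub0r.
  suff : (x *m B) 0 r / c 0 r * c 0 i <= (x *m B) 0 i.
    by set q := _ / c 0 r; move=> ?; nra.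
  have [ci|ci] := ltP 0 (c 0 i).
    by rewrite -[leRHS](divfK (lt0r_neq0 ci)) ler_pM2r //; exact: minr.
  by apply: le_trans (xS i); rewrite mulr_ge0_le0 // ltW.
rewrite (basis_mxP pB) pivot_cost -/B -/c lerDl leNgt.
by rewrite pmulr_rlt0 ?subr_lt0 ?wj.
Qed.

End SimplexMethod.

(** * Generic perturbations *)

Section SmallParameter.
Variable R : realFieldType.

Definition for_small (P : R -> Prop) : Prop :=
  exists2 e0, 0 < e0 & forall e, 0 < e -> e <= e0 -> P e.

Lemma for_smallP (P : R -> Prop) : for_small P -> exists2 e, 0 < e & P e.
Proof. by case=> e e0 Pe; exists e => //; apply: Pe. Qed.

Lemma for_small_all P : (forall e, P e) -> for_small P.
Proof. by move=> allP; exists 1. Qed.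

Lemma for_small_and P Q :
  for_small P -> for_small Q -> for_small (fun e => P e /\ Q e).
Proof.
move=> [a a0 Pa] [b b0 Qb]; exists (Order.min a b); first by rewrite lt_min a0.
by move=> e e0; rewrite le_min => /andP[ea eb]; split; [apply: Pa|apply: Qb].
Qed.

Lemma for_small_forall (I : finType) (P : I -> R -> Prop) :
  (forall i, for_small (P i)) -> for_small (fun e => forall i, P i e).
Proof.
move=> sP.
suff [e0 e0_gt0 Pe] : for_small (fun e => forall i, i \in enum I -> P i e).
  by exists e0 => // e egt0 le_e i; apply: Pe; rewrite ?mem_enum.
elim: (enum I) => [|i s IHs]; first exact: for_small_all.
have [e0 e0_gt0 Pe] := for_small_and (sP i) IHs.
exists e0 => // e egt0 le_e j; have [Pi Ps] := Pe e egt0 le_e.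
by rewrite inE => /predU1P[->|/Ps].
Qed.

Lemma for_small_pos (a b : R) : 0 < a -> for_small (fun e => 0 < a + e * b).
Proof.
move=> a0; have b1 : 0 < `|b| + 1 by rewrite ltr_pwDr.
exists (a / (`|b| + 1)); first exact: divr_gt0.
move=> e e0; rewrite ler_pdivlMr // => le_e.
have : - (e * b) <= e * `|b| by rewrite -mulrN ler_pM2l // -normrN ler_norm.
by lra.
Qed.

(* Positivity of a + e * b for all small e > 0. *)
Definition lexpos (a b : R) : bool := (0 < a) || ((a == 0) && (0 < b)).

Lemma for_small_lexpos (a b : R) : b != 0 ->
  for_small (fun e => (a + e * b != 0) /\ (0 < a + e * b) = lexpos a b).
Proof.
move=> b0; rewrite /lexpos; have [a_neg|a_pos|a0] := ltgtP a 0.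
- have Na : 0 < - a by rewrite oppr_gt0.
  have [e0 e0_gt0 pos] := for_small_pos (- b) Na.
  exists e0 => // e e_gt0 le_e; have neg := pos e e_gt0 le_e.
  have lt0 : a + e * b < 0 by lra.
  by rewrite (lt_eqF lt0) (lt_gtF lt0).
- have [e0 e0_gt0 pos] := for_small_pos b a_pos.
  exists e0 => // e e_gt0 le_e; have := pos e e_gt0 le_e => pos_e.
  by rewrite (gt_eqF pos_e) pos_e.
- exists 1 => // e e_gt0 _; rewrite a0 add0r pmulr_rgt0 //.
  by split=> //; rewrite mulf_eq0 (gt_eqF e_gt0) (negPf b0).
Qed.

(* The moment curve (1, t, t^2, ...) meets every hyperplane finitely often. *)
Lemma avoid_hyperplanes (I : finType) k (r : I -> 'rV[R]_k) :
  exists w : 'cV[R]_k, (forall j, 0 < w j 0) /\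
    forall i, r i != 0 -> (r i *m w) 0 0 != 0.
Proof.
pose p := \prod_(i | r i != 0) rVpoly (r i).
have p0 : p != 0.
  apply/prodf_neq0 => i; apply: contraNneq => ri0.
  by rewrite -(rVpolyK (r i)) ri0 linear0.
(* The nonzero [p] cannot vanish at all of 1, ..., [size p]. *)
have [t t_gt0 pt] : exists2 t : R, 0 < t & ~~ root p t.
  apply: contrapT => no_t; suff : (size p < size p)%N by rewrite ltnn.
  pose s := [seq i.+1%:R : R | i <- iota 0 (size p)].
  have {1}<- : size s = size p by rewrite size_map size_iota.
  have us : uniq s.
    rewrite map_inj_uniq ?iota_uniq // => i j /eqP.
    by rewrite eqr_nat eqSS => /eqP.
  apply: max_poly_roots us => //; apply/allP => _ /mapP[i _ ->].
  by apply: contra_notT no_t => nr; exists i.+1%:R.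
exists (\col_j t ^+ j); split=> [j|i ri]; first by rewrite mxE exprn_gt0.
have := pt; rewrite /root horner_prod.
move/prodf_neq0 => /(_ i ri); rewrite horner_poly mxE.
congr (_ != 0); apply: eq_bigr => j _; rewrite mxE insubT //= => jk.
by congr (r i 0 _ * _); apply: val_inj.
Qed.

End SmallParameter.

Section Generic.
Variables (R : realFieldType) (k N : nat) (A : 'M[R]_(k, N)).

Lemma coord_basis_exists : \rank A = N -> exists S B, coord_basis A S B.
Proof.
move=> rA; have fA : row_full A by rewrite /row_full rA.
pose g := fullrankfun fA; pose M := rowsub g A.
have uM : M \in unitmx by exact: fullrowsub_unit.
pose P : 'M[R]_(N, k) := rowsub g 1%:M.
have PA : P *m A = M by rewrite /P mul_rowsub_mx mul1mx.
exists [set g i | i : 'I_N], (invmx M *m P); split.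
- by rewrite -mulmxA PA mulVmx.
- move=> i j jS; rewrite mxE big1 // => l _.
  rewrite !mxE; case: eqP => [gl|]; last by rewrite mulr0.
  by rewrite -gl imset_f in jS.
- move=> _ /imsetP[i _ ->]; have -> : row (g i) A = row i M.
    by apply/rowP => l; rewrite !mxE.
  by rewrite mulmxA -row_mul mulmxV // row1 -rowE /P row_rowsub row1.
Qed.

(** Finitely many hyperplanes are avoided. The same [w] will serve as cost vector and, through
    [w^T *m A], as direction of perturbation. *)
Lemma generic_weights : exists w : 'cV[R]_k, [/\ forall j, 0 < w j 0,
  forall S B j, coord_basis A S B -> j \notin S ->
    (row j A *m B *m w) 0 0 != w j 0
  & forall S B i, coord_basis A S B -> i \in S -> (w^T *m A *m B) 0 i != 0].
Proof.
pose r (x : {set 'I_k} * 'I_k * bool) : 'rV[R]_k :=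
  let B := basis_mx A x.1.1 in
  if x.2 then row x.1.2 A *m B - delta_mx 0 x.1.2 else (col x.1.2 (A *m B))^T.
have [w [w_gt0 rw]] := avoid_hyperplanes r.
exists w; split=> // S B j SB jS; have := basis_mxP SB => EB.
  have := rw (S, j, true); rewrite /r /= EB.
  have -> : ((row j A *m B - delta_mx 0 j) *m w) 0 0 =
      (row j A *m B *m w) 0 0 - w j 0.
    by rewrite mulmxBl -rowE [LHS]mxE [X in _ + X]mxE [row _ w _ _]mxE.
  move=> rw0; rewrite -subr_eq0; apply: rw0.
  apply: contraTneq isT => /rowP/(_ j); rewrite [LHS]mxE [X in _ + X]mxE.
  rewrite (coord_basis_notin _ SB jS) !mxE !eqxx => /eqP.
  by rewrite add0r oppr_eq0 oner_eq0.
have := rw (S, j, false); rewrite /r /= EB => h.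
have -> : (w^T *m A *m B) 0 j = ((col j (A *m B))^T *m w) 0 0.
  rewrite -mulmxA -[w in RHS]trmxK -trmx_mul [RHS]mxE colE [in RHS]mulmxA -colE.
  by rewrite [RHS]mxE mulmxA.
apply: h; apply: contraTneq isT => /rowP/(_ j).
have [_ _ BS] := SB; have := BS _ jS; rewrite -row_mul => /rowP/(_ j).
by rewrite !mxE !eqxx => -> /eqP; rewrite oner_eq0.
Qed.

End Generic.

(** * Ehrhart reciprocity *)

(** On generating series this is multiplication by [1 - t]. *)
Definition bdiff (f : nat -> int) (m : nat) : int :=
  f m - (if m is m'.+1 then f m' else 0).

Lemma eq_bdiff f g : f =1 g -> bdiff f =1 bdiff g.
Proof. by move=> fg [|m]; rewrite /bdiff !fg. Qed.

Lemma eq_iter_bdiff N f g : f =1 g -> iter N bdiff f =1 iter N bdiff g.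
Proof. by move=> fg; elim: N => //= N IH; exact: eq_bdiff. Qed.

Lemma iter_bdiff_sum (I : finType) (P : pred I) (f : I -> nat -> int) N m :
  iter N bdiff (fun m => \sum_(i | P i) f i m) m =
  \sum_(i | P i) iter N bdiff (f i) m.
Proof.
elim: N m => //= N IH m; rewrite (eq_bdiff IH) /bdiff sumrB.
by case: m => [|m] //; rewrite [X in _ = _ - X]big1.
Qed.

Lemma iter_bdiffE N f m :
  iter N bdiff f m =
  \sum_(i < m.+1) (-1) ^+ i * ('C(N, i))%:Z * f (m - i)%N.
Proof.
elim: N f m => [|N IH] f m.
  rewrite big_ord_recl big1 /= ?subn0 ?mul1r ?addr0 // => i _.
  by rewrite mulr0 mul0r.
rewrite iterSr IH.
pose t i := (-1) ^+ i * ('C(N, i))%:Z.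
(* The extension by zero encodes the value 0 that [bdiff] uses below index 0. *)
pose g i := if (i <= m)%N then f (m - i)%N else 0.
have -> : \sum_(i < m.+1) (-1) ^+ i * ('C(N, i))%:Z * bdiff f (m - i) =
   \sum_(i < m.+1) t i * g i - \sum_(i < m.+1) t i * g i.+1.
  rewrite -sumrB; apply: eq_bigr => i _; rewrite -mulrBr; congr (_ * _).
  rewrite /bdiff /g -ltnS ltn_ord; congr (_ - _).
  case: ltnP => im; first by rewrite -subnSK.
  by have -> : (m - i = 0)%N by apply/eqP; rewrite subn_eq0.
have -> : \sum_(i < m.+1) t i * g i.+1 = \sum_(i < m) t i * g i.+1.
  by rewrite big_ord_recr /= {2}/g ltnn mulr0 addr0.
rewrite !big_ord_recl /= -addrA -sumrB; congr (_ + _).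
  by rewrite /t /g !bin0 /= subn0.
apply: eq_bigr => i _; rewrite /t /g /bump /= add1n ltn_ord.
by rewrite binS PoszD exprS; ring.
Qed.

Lemma hstar_coefE n L m :
  hstar_coef n L m = iter n.+1 bdiff (fun m => (L m)%:Z) m.
Proof. by rewrite iter_bdiffE. Qed.

(** * Arithmetic of integral matrices *)

Section IntegralMatrices.
Variable R : realType.
Implicit Types m n p : nat.

Lemma int_mxD m n (B C : 'M[R]_(m, n)) :
  B \is a mxOver Num.int -> C \is a mxOver Num.int -> B + C \is a mxOver Num.int.
Proof.
by move=> /mxOverP hB /mxOverP hC; apply/mxOverP => i j; rewrite mxE rpredD.
Qed.

Lemma int_mxZ m n (a : R) (B : 'M[R]_(m, n)) :
  a \is a Num.int -> B \is a mxOver Num.int -> a *: B \is a mxOver Num.int.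
Proof.
by move=> ha /mxOverP hB; apply/mxOverP => i j; rewrite mxE rpredM.
Qed.

Lemma int_mxB m n (B C : 'M[R]_(m, n)) :
  B \is a mxOver Num.int -> C \is a mxOver Num.int -> B - C \is a mxOver Num.int.
Proof.
by move=> /mxOverP hB /mxOverP hC; apply/mxOverP => i j; rewrite !mxE rpredB.
Qed.

Lemma int_mx_sum m n (I : finType) (P : pred I) (F : I -> 'M[R]_(m, n)) :
  (forall i, P i -> F i \is a mxOver Num.int) ->
  \sum_(i | P i) F i \is a mxOver Num.int.
Proof.
move=> hF; apply/mxOverP => i j; rewrite summxE rpred_sum // => l Pl.
by have /mxOverP := hF l Pl.
Qed.

Lemma int_mxM m n p (B : 'M[R]_(m, n)) (C : 'M[R]_(n, p)) :
  B \is a mxOver Num.int -> C \is a mxOver Num.int -> B *m C \is a mxOver Num.int.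
Proof.
move=> /mxOverP hB /mxOverP hC; apply/mxOverP => i j.
by rewrite mxE rpred_sum // => l _; rewrite rpredM.
Qed.

Lemma int_mx_row m n (B : 'M[R]_(m, n)) i :
  B \is a mxOver Num.int -> row i B \is a mxOver Num.int.
Proof. by move=> /mxOverP hB; apply/mxOverP => a b; rewrite mxE. Qed.

End IntegralMatrices.

(** * The cone over the rows of a matrix, graded by height *)

Section Cone.
Variables (R : realType) (k N : nat) (A : 'M[R]_(k, N)) (h : 'cV[R]_N).

Definition cone (x : 'rV[R]_N) : Prop :=
  exists2 mu : 'rV[R]_k, (forall j, 0 <= mu 0 j) & x = mu *m A.

Definition open_cone (x : 'rV[R]_N) : Prop :=
  exists2 mu : 'rV[R]_k, (forall j, 0 < mu 0 j) & x = mu *m A.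

Definition height (x : 'rV[R]_N) : R := (x *m h) 0 0.

Lemma heightD x y : height (x + y) = height x + height y.
Proof. by rewrite /height mulmxDl mxE. Qed.

Lemma heightN x : height (- x) = - height x.
Proof. by rewrite /height mulNmx mxE. Qed.

Lemma heightB x y : height (x - y) = height x - height y.
Proof. by rewrite heightD heightN. Qed.

Lemma heightZ a x : height (a *: x) = a * height x.
Proof. by rewrite /height -scalemxAl mxE. Qed.

Lemma height_sum (I : finType) (P : pred I) (F : I -> 'rV_N) :
  height (\sum_(i | P i) F i) = \sum_(i | P i) height (F i).
Proof. by rewrite /height mulmx_suml summxE. Qed.

Lemma cone0 : cone 0.
Proof. by exists 0 => [j|]; rewrite ?mxE ?mul0mx. Qed.

Lemma coneD x y : cone x -> cone y -> cone (x + y).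
Proof.
move=> [mu mu0 ->] [nu nu0 ->]; exists (mu + nu); last by rewrite mulmxDl.
by move=> j; rewrite mxE addr_ge0.
Qed.

Lemma coneZ a x : 0 <= a -> cone x -> cone (a *: x).
Proof.
move=> a0 [mu mu0 ->]; exists (a *: mu); last by rewrite scalemxAl.
by move=> j; rewrite mxE mulr_ge0.
Qed.

Lemma cone_row i : cone (row i A).
Proof. by exists (delta_mx 0 i) => [j|]; rewrite ?rowE // mxE ler0n. Qed.

Hypothesis Ah : A *m h = const_mx 1.

Lemma height_row i : height (row i A) = 1.
Proof. by rewrite /height -row_mul Ah !mxE. Qed.

Lemma height_mul (mu : 'rV_k) : height (mu *m A) = \sum_j mu 0 j.
Proof.
rewrite /height -mulmxA Ah mxE; apply: eq_bigr => j _.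
by rewrite mxE mulr1.
Qed.

Lemma cone_height_ge0 x : cone x -> 0 <= height x.
Proof. by move=> [mu mu0 ->]; rewrite height_mul sumr_ge0. Qed.

End Cone.

(** * Half-open triangulations and lattice points in boxes *)

Section HalfOpenDecomposition.
Variables (R : realType) (k N : nat) (A : 'M[R]_(k, N)) (h : 'cV[R]_N).
Hypothesis Ah : A *m h = const_mx 1.
Hypothesis A_int : A \is a mxOver Num.int.
Hypothesis h_int : h \is a mxOver Num.int.
Hypothesis rankA : \rank A = N.
Variable w : 'cV[R]_k.
Hypothesis w_gt0 : forall j, 0 < w j 0.
Hypothesis w_dual : forall S B j, coord_basis A S B -> j \notin S ->
  (row j A *m B *m w) 0 0 != w j 0.
Hypothesis w_primal : forall S B i, coord_basis A S B -> i \in S ->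
  (w^T *m A *m B) 0 i != 0.
Variable s : nat -> seq 'rV[R]_N.
Hypothesis s_uniq : forall m, uniq (s m).
Hypothesis sP : forall m x, x \in s m <->
  [/\ x \is a mxOver Num.int, height h x = m%:R & cone A x].

Let y := w^T *m A.

(* The maximal cells of the regular triangulation with heights w. *)
Definition cell (S : {set 'I_k}) : bool :=
  `[< coord_basis A S (basis_mx A S) /\
      dual_feasible A w S (basis_mx A S) >].

Definition cell_coord (S : {set 'I_k}) (x : 'rV_N) (i : 'I_k) : R :=
  (x *m basis_mx A S) 0 i.

(* The point x + e *: y lies in the open cone over S for small e > 0. *)
Definition half_open (S : {set 'I_k}) (x : 'rV_N) : bool :=
  [forall i in S, lexpos (cell_coord S x i) (cell_coord S y i)].

(** Together with [half_open], this confines the coordinate to [0,1) or (0,1] according to the sign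
    of that coordinate of [y]. *)
Definition boxed (S : {set 'I_k}) (x : 'rV_N) (i : 'I_k) : bool :=
  if 0 < cell_coord S y i then cell_coord S x i < 1 else cell_coord S x i <= 1.

Lemma cell_basis S : cell S -> coord_basis A S (basis_mx A S).
Proof. by move/asboolP=> []. Qed.

Lemma coordD S x x' i : cell_coord S (x + x') i = cell_coord S x i + cell_coord S x' i.
Proof. by rewrite /cell_coord mulmxDl mxE. Qed.

Lemma coordZ S a x i : cell_coord S (a *: x) i = a * cell_coord S x i.
Proof. by rewrite /cell_coord -scalemxAl mxE. Qed.

Lemma coordN S x i : cell_coord S (- x) i = - cell_coord S x i.
Proof. by rewrite /cell_coord mulNmx mxE. Qed.

Lemma coord_row S i j : cell S -> i \in S -> cell_coord S (row i A) j = (i == j)%:R.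
Proof.
move=> /cell_basis[_ _ BS] iS; rewrite /cell_coord BS // mxE eqxx.
by rewrite [i == j]eq_sym.
Qed.

Lemma coord_y_neq0 S i : cell S -> i \in S -> cell_coord S y i != 0.
Proof. by move=> /cell_basis SB iS; exact: w_primal SB iS. Qed.

Lemma coord_sum S x : cell S -> x = \sum_(i in S) cell_coord S x i *: row i A.
Proof.
move=> /cell_basis SB; rewrite -[LHS](coord_basisK x SB) mulmx_sum_row.
rewrite [RHS]big_mkcond; apply: eq_bigr => i _; case: ifPn => // iS.
by rewrite (coord_basis_notin _ SB iS) scale0r.
Qed.

Lemma half_open_ge0 S x i : half_open S x -> i \in S -> 0 <= cell_coord S x i.
Proof.
move=> /forallP/(_ i)/implyP xS iS; have := xS iS.
by rewrite /lexpos => /orP[/ltW //|/andP[/eqP-> _]].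
Qed.

Lemma half_open_cone S x : cell S -> half_open S x -> cone A x.
Proof.
move=> cS xS; rewrite (coord_sum x cS).
apply: (big_ind (cone A)) => [||i iS]; [exact: cone0|exact: coneD|].
by apply: coneZ; [exact: half_open_ge0 xS iS|exact: cone_row].
Qed.

(** Linear programming is applied to [x + e *: y'] for one [e] so small that all signs in all bases
    are those given by [lexpos]. The direction is left free because both [y] and [-y] occur. *)
Lemma cell_exists (x y' : 'rV_N) :
  (forall S B i, coord_basis A S B -> i \in S -> (y' *m B) 0 i != 0) ->
  for_small (fun e => cone A (x + e *: y')) ->
  exists2 S, cell S & forall i, i \in S -> lexpos (cell_coord S x i) (cell_coord S y' i).
Proof.
move=> y'0 sc.
have small S i : for_small (fun e => forall B, coord_basis A S B -> i \in S ->
   ((x *m B) 0 i + e * (y' *m B) 0 i != 0) /\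
   (0 < (x *m B) 0 i + e * (y' *m B) 0 i) =
   lexpos ((x *m B) 0 i) ((y' *m B) 0 i)).
  have [[B SB]|noB] := pselect (exists B, coord_basis A S B); last first.
    by apply: for_small_all => e B SB; case: noB; exists B.
  have [iS|iS] := boolP (i \in S); last exact: for_small_all.
  have [e0 e00 P] := for_small_lexpos ((x *m B) 0 i) (y'0 _ _ _ SB iS).
  exists e0 => // e e_gt0 le_e B' SB' _.
  by rewrite (coord_basis_uniq SB' SB); exact: P.
have [e e_gt0 [[mu mu0 xe] Pe]] := for_smallP (for_small_and sc
  (for_small_forall (fun S => for_small_forall (small S)))).
have coE B i : ((x + e *: y') *m B) 0 i = (x *m B) 0 i + e * (y' *m B) 0 i.
  by rewrite mulmxDl -scalemxAl mxE [X in _ + X]mxE.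
have [S0 [B0 SB0]] := coord_basis_exists rankA.
have [S1 [B1 [SB1 pos1]]] := cone_basis SB0 mu0.
rewrite -xe in pos1.
have [|S [SB dS posS]] := dual_feasible_exists Ah w_dual _ SB1 pos1.
  move=> S B i SB iS; rewrite coE; by have [] := Pe S i B SB iS.
exists S; first by apply/asboolP.
move=> i iS; have [_ <-] := Pe S i _ SB iS; rewrite -coE; exact: posS.
Qed.

Lemma cell_uniq S S' x : cell S -> cell S' -> half_open S x ->
  half_open S' x -> S = S'.
Proof.
move=> cS cS' xS xS'.
have small T i : cell T -> half_open T x -> i \in T ->
    for_small (fun e => 0 < ((x + e *: y) *m basis_mx A T) 0 i).
  move=> cT /forallP/(_ i)/implyP xT iT; have := xT iT => lex.
  have [e0 e00 P] := for_small_lexpos (cell_coord T x i) (coord_y_neq0 cT iT).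
  exists e0 => // e e_gt0 le_e; have [_] := P e e_gt0 le_e.
  by rewrite -/(cell_coord T (x + e *: y) i) coordD coordZ lex => ->.
have small' T : cell T -> half_open T x -> for_small (fun e =>
    forall i, i \in T -> 0 < ((x + e *: y) *m basis_mx A T) 0 i).
  move=> cT xT; apply: for_small_forall => i.
  have [iT|iT] := boolP (i \in T); last exact: for_small_all.
  have [e0 e00 P] := small T i cT xT iT.
  by exists e0 => // e e_gt0 le_e _; exact: P.
have [e e_gt0 [p p']] := for_smallP (for_small_and (small' S cS xS)
  (small' S' cS' xS')).
move: cS cS' => /asboolP[SB dS] /asboolP[SB' dS'].
exact: dual_feasible_uniq SB SB' dS dS' p p'.
Qed.

Lemma for_small_cone x : cone A x -> for_small (fun e => cone A (x + e *: y)).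
Proof.
move=> cx; exists 1 => // e e_gt0 _; apply: coneD => //; apply: coneZ.
  exact: ltW.
by exists w^T => // j; rewrite mxE ltW.
Qed.

Lemma size_cells m :
  (size (s m))%:Z = \sum_(S | cell S) (count (half_open S) (s m))%:Z.
Proof.
rewrite -(big_morph Posz PoszD (erefl _)); congr Posz.
rewrite -sum1_size; under [RHS]eq_bigr do rewrite -sum1_count big_mkcond.
rewrite exchange_big /= [LHS]big_seq [RHS]big_seq; apply: eq_bigr => x xs.
have [x_int xh cx] := (sP m x).1 xs.
have [S cS lexS] := cell_exists w_primal (for_small_cone cx).
have xS : half_open S x by apply/forallP => i; apply/implyP; exact: lexS.
rewrite (bigD1 S) //= xS big1 ?addn0 // => S' /andP[cS' S'S].
by case: ifP => // xS'; rewrite (cell_uniq cS' cS xS' xS) eqxx in S'S.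
Qed.

(* Points outside the unit box in direction i are translates by row i A of
   points of height one less. *)
Lemma shift_box S l i m : cell S -> i \in S -> i \notin l ->
  (count (fun x => half_open S x && all (boxed S x) (i :: l)) (s m))%:Z =
  bdiff (fun m => (count (fun x => half_open S x && all (boxed S x) l)
           (s m))%:Z) m.
Proof.
move=> cS iS il; set P := fun x => half_open S x && all (boxed S x) l.
pose Q x := P x && ~~ boxed S x i.
have cPQ : count P (s m) =
    (count (fun x => half_open S x && all (boxed S x) (i :: l)) (s m)
     + count Q (s m))%N.
  rewrite -[RHS]count_predUI [X in (_ + X)%N](@eq_count _ _ pred0) ?count_pred0.
    rewrite addn0; apply: eq_count => x; rewrite /= /Q /P /=.
    by case: half_open; case: boxed; case: all.
  by move=> x; rewrite /= /Q /P /=; case: boxed; rewrite ?andbF.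
have shift x j : cell_coord S (x + row i A) j = cell_coord S x j + (i == j)%:R.
  by rewrite coordD coord_row.
have yi := coord_y_neq0 cS iS.
(* Only the i-th coordinate moves, by 1, and the strictness at the upper end of the box matches that
   of the half-open condition at 0. *)
have QE x : Q (x + row i A) = P x.
  rewrite /Q /P.
  have -> : all (boxed S (x + row i A)) l = all (boxed S x) l.
    apply: eq_in_all => j jl; rewrite /boxed shift.
    by have /negPf-> : i != j by [apply: contraNneq il => ->]; rewrite addr0.
  have [_|] := boolP (all _ _); rewrite ?andbT ?andbF //.
  apply/andP/idP => [[xS xi]|xS].
    apply/forallP => j; apply/implyP => jS.
    have [ij|ij] := eqVneq i j; last first.
      by have /forallP/(_ j)/implyP/(_ jS) := xS; rewrite shift (negPf ij) addr0.
    rewrite -ij /lexpos; move: xi; rewrite /boxed shift eqxx /=.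
    case: ifPn => [yi0|yi0]; rewrite -?leNgt -?ltNge => xi.
      have : 0 <= cell_coord S x i by lra.
      by rewrite le_eqVlt eq_sym => /orP[->|->]; rewrite ?orbT.
    by have -> : 0 < cell_coord S x i by lra.
  have xi : lexpos (cell_coord S x i) (cell_coord S y i).
    by have /forallP/(_ i)/implyP/(_ iS) := xS.
  split.
    apply/forallP => j; apply/implyP => jS; rewrite shift.
    have [<-|ij] := eqVneq i j; last first.
      by rewrite addr0; have /forallP/(_ j)/implyP/(_ jS) := xS.
    move: xi; rewrite /lexpos => /orP[xi|/andP[/eqP-> _]].
      by rewrite addr_gt0.
    by rewrite add0r ltr01.
  rewrite /boxed shift eqxx /=; move: xi; rewrite /lexpos.
  case: (ltgtP 0 (cell_coord S y i)) yi => // yi _.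
    by rewrite andbT -leNgt => /orP[?|/eqP->]; lra.
  by rewrite andbF orbF -ltNge => ?; lra.
have nil0 : forall x, x \in s m -> Q x ->
    exists2 m', m = m'.+1 & (x - row i A) \in s m'.
  move=> x /sP[x_int xh cx]; rewrite -[x in Q x](subrK (row i A)) QE => /andP[xS _].
  have cx' := half_open_cone cS xS.
  have := cone_height_ge0 Ah cx'; rewrite heightB height_row // xh.
  case: m {cPQ} xh => [|m'] xh; first by rewrite sub0r oppr_ge0 ler10.
  move=> _; exists m' => //; apply/sP; split=> //.
    by rewrite int_mxB ?int_mx_row.
  by rewrite heightB height_row // xh -natr1 addrK.
rewrite /bdiff -/P cPQ PoszD -addrA [X in _ = _ + X](_ : _ = 0) ?addr0 //.
case: m nil0 {cPQ} => [|m] nil0.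
  rewrite subr0; congr Posz; apply/eqP; rewrite eqn0Ngt -has_count.
  by apply/hasP => -[x xs /(nil0 x xs)[]].
apply/eqP; rewrite subr_eq0 -!size_filter; apply/eqP; congr Posz.
rewrite -(size_map (fun x => x + row i A) (filter P _)); apply: perm_size.
apply: uniq_perm; rewrite ?map_inj_uniq ?filter_uniq //; first exact: addIr.
move=> x; rewrite mem_filter; apply/andP/mapP => [[Qx xs]|[x' + ->]].
  have [m' [<-] xs'] := nil0 x xs Qx; exists (x - row i A); rewrite ?subrK //.
  by rewrite mem_filter xs' -QE subrK Qx.
rewrite mem_filter QE => /andP[Px' /sP[x'_int x'h cx']]; split=> //.
apply/sP; split; first by rewrite int_mxD ?int_mx_row.
  by rewrite heightD height_row // x'h natr1.
by apply: coneD => //; exact: cone_row.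
Qed.

(** A cell has [N] rows, and each difference imposes the box condition for one of them. *)
Lemma iter_bdiff_cell S m : cell S ->
  iter N bdiff (fun m => (count (half_open S) (s m))%:Z) m =
  (count (fun x => half_open S x && all (boxed S x) (enum S)) (s m))%:Z.
Proof.
move=> cS; have -> : iter N = @iter (nat -> int) (size (enum S)).
  by rewrite -cardE (coord_basis_card (cell_basis cS)).
have : {subset enum S <= S} by move=> i; rewrite mem_enum.
have := enum_uniq S; elim: (enum S) m => [|i l IH] m.
  move=> _ _ /=; congr Posz; apply: eq_count => x; by rewrite andbT.
move=> /= /andP[il ul] sub; have iS : i \in S by rewrite sub ?mem_head.
rewrite [RHS](shift_box _ cS iS il); apply: eq_bdiff => m'.
by apply: IH => // j jl; rewrite sub // inE jl orbT.
Qed.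

(** The iterated difference is a sum of cardinalities, so where it vanishes every box is empty. *)
Lemma half_open_box_height d S x m :
  (forall j, (d < j)%N -> iter N bdiff (fun m => (size (s m))%:Z) j = 0) ->
  cell S -> half_open S x -> all (boxed S x) (enum S) -> x \in s m -> (m <= d)%N.
Proof.
move=> hd cS xS xb xs; rewrite leqNgt; apply/negP => /hd.
rewrite (eq_iter_bdiff _ size_cells) iter_bdiff_sum.
under eq_bigr => T cT do rewrite iter_bdiff_cell //.
rewrite -(big_morph Posz PoszD (erefl _)) => /eqP; rewrite eqz_nat sum_nat_eq0.
move=> /forallP/(_ S)/implyP/(_ cS); rewrite eqn0Ngt -has_count => /hasPn/(_ x xs).
by rewrite xS xb.
Qed.

(** A cell for the direction [-y] is used. Rounding the coordinates of [z] up to integers at least 1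
    and subtracting [z] gives a box point [b] for [y], whose height is at most [d] and at least
    [N - height h z]. *)
Lemma open_cone_height_weighted d z :
  (forall j, (d < j)%N -> iter N bdiff (fun m => (size (s m))%:Z) j = 0) ->
  z \is a mxOver Num.int -> open_cone A z -> N%:R <= d%:R + height h z.
Proof.
move=> hd z_int [mu mu_gt0 zE].
have [||S cS lexS] := @cell_exists z (- y).
- by move=> S B i SB iS; rewrite mulNmx mxE oppr_eq0; exact: w_primal SB iS.
- have [e0 e00 P] := for_small_forall (fun j => for_small_pos (- w j 0) (mu_gt0 j)).
  exists e0 => // e e_gt0 le_e; exists (mu - e *: w^T).
    move=> j; have := P e e_gt0 le_e j; rewrite mulrN !mxE; exact: ltW.
  by rewrite mulmxBl -scalemxAl zE scalerN.
(* The two roundings differ only at integers: [t i] minus the coordinate lies in [0,1) or in (0,1],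
   as the box requires. *)
pose t i : int := if 0 < cell_coord S y i then Num.ceil (cell_coord S z i)
                  else Num.floor (cell_coord S z i) + 1.
have t_ge1 i : i \in S -> 1 <= (t i)%:~R :> R.
  move=> iS; have := lexS i iS; rewrite /t /lexpos coordN oppr_gt0.
  have := coord_y_neq0 cS iS; case: (ltgtP 0 (cell_coord S y i)) => // yi _;
    rewrite ?andbF ?orbF ?andbT.
    by move=> zi; rewrite ler1z -gtz0_ge1 ceil_gt0.
  rewrite eq_sym => zi; have : 0 <= cell_coord S z i by rewrite le_eqVlt orbC.
  by rewrite -floor_ge0 => zi'; rewrite ler1z lerDr.
pose b := \sum_(i in S) (t i)%:~R *: row i A - z.
have bE i : i \in S -> cell_coord S b i = (t i)%:~R - cell_coord S z i.
  move=> iS; rewrite /b coordD coordN; congr (_ - _).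
  rewrite /cell_coord mulmx_suml summxE (bigD1 i) //= big1 ?addr0.
    by rewrite -/(cell_coord _ _ _) coordZ coord_row // eqxx mulr1.
  move=> j /andP[jS ji]; rewrite -/(cell_coord _ _ _) coordZ coord_row //.
  by rewrite (negPf ji) mulr0.
have b_int : b \is a mxOver Num.int.
  by rewrite int_mxB // int_mx_sum // => i _; rewrite int_mxZ ?intr_int ?int_mx_row.
have bS : half_open S b.
  apply/forallP => i; apply/implyP => iS; rewrite bE // /lexpos /t.
  have := coord_y_neq0 cS iS; case: (ltgtP 0 (cell_coord S y i)) => // yi _.
    by rewrite andbT orbC eq_sym -le_eqVlt subr_ge0 ceil_ge.
  by rewrite subr_gt0 floorD1_gt.
have bb : all (boxed S b) (enum S).
  apply/allP => i; rewrite mem_enum => iS; rewrite /boxed bE // /t.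
  case: (ltP 0 (cell_coord S y i)) => _.
    by have := ceilB1_lt (cell_coord S z i); rewrite intrB mulr1z; lra.
  by have := floor_le (cell_coord S z i); rewrite intrD mulr1z; lra.
have cb := half_open_cone cS bS.
have hb_ge0 := cone_height_ge0 Ah cb.
have /natrP[m hm] : height h b \is a Num.nat.
  rewrite natrEint hb_ge0 andbT /height; apply: (mxOverP _).
  exact: int_mxM.
have bs : b \in s m by apply/sP.
have := half_open_box_height hd cS bS bb bs; rewrite -(ler_nat R) -hm.
rewrite /b heightB height_sum.
have : N%:R <= \sum_(i in S) height h ((t i)%:~R *: row i A).
  have <- : #|S|%:R = N%:R :> R.
    by rewrite (coord_basis_card (cell_basis cS)).
  rewrite -sum1_card natr_sum.
  by apply: ler_sum => i iS; rewrite heightZ height_row // mulr1 t_ge1.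
lra.
Qed.

End HalfOpenDecomposition.

Lemma open_cone_height (R : realType) (k N : nat) (A : 'M[R]_(k, N))
    (h : 'cV[R]_N) (s : nat -> seq 'rV[R]_N) (d : nat) (z : 'rV[R]_N) :
  A *m h = const_mx 1 -> A \is a mxOver Num.int -> h \is a mxOver Num.int ->
  \rank A = N -> (forall m, uniq (s m)) ->
  (forall m x, x \in s m <->
     [/\ x \is a mxOver Num.int, height h x = m%:R & cone A x]) ->
  (forall j, (d < j)%N -> iter N bdiff (fun m => (size (s m))%:Z) j = 0) ->
  z \is a mxOver Num.int -> open_cone A z -> N%:R <= d%:R + height h z.
Proof.
move=> Ah A_int h_int rankA s_uniq sP hd z_int zA.
have [w [w_gt0 w_dual w_primal]] := generic_weights A.
exact: (open_cone_height_weighted Ah A_int h_int rankA w_gt0 w_dual w_primal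
  s_uniq sP hd z_int zA).
Qed.

(** * Coordinates with respect to a simplex of vertices *)

Section Simplex.
Variables (R : realType) (k N : nat) (A : 'M[R]_(k, N)) (h : 'cV[R]_N).
Hypothesis Ah : A *m h = const_mx 1.
Hypothesis A_int : A \is a mxOver Num.int.
Hypothesis h_int : h \is a mxOver Num.int.
Variable g : 'I_N -> 'I_k.
Let M := rowsub g A.
Hypothesis M_unit : M \in unitmx.
Variable d : nat.
Hypothesis codegree : forall z : 'rV[R]_N,
  z \is a mxOver Num.int -> open_cone A z -> N%:R <= d%:R + height h z.

Definition bary (x : 'rV[R]_N) (i : 'I_N) : R := (x *m invmx M) 0 i.

Lemma baryD x y i : bary (x + y) i = bary x i + bary y i.
Proof. by rewrite /bary mulmxDl mxE. Qed.

Lemma baryN x i : bary (- x) i = - bary x i.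
Proof. by rewrite /bary mulNmx mxE. Qed.

Lemma baryB x y i : bary (x - y) i = bary x i - bary y i.
Proof. by rewrite baryD baryN. Qed.

Lemma baryZ a x i : bary (a *: x) i = a * bary x i.
Proof. by rewrite /bary -scalemxAl mxE. Qed.

Lemma bary0 i : bary 0 i = 0.
Proof. by rewrite /bary mul0mx mxE. Qed.

Lemma bary_row i j : bary (row i M) j = (i == j)%:R.
Proof. by rewrite /bary -row_mul mulmxV // row1 mxE eqxx [j == i]eq_sym. Qed.

Lemma bary_sum (P : pred 'I_N) (a : 'I_N -> R) j :
  bary (\sum_(i | P i) a i *: row i M) j = if P j then a j else 0.
Proof.
rewrite /bary mulmx_suml summxE big_mkcond (bigD1 j) //= big1 ?addr0.
  by case: ifP => // _; rewrite -/(bary _ _) baryZ bary_row eqxx mulr1.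
move=> i ij; case: ifP => // _.
by rewrite -/(bary _ _) baryZ bary_row (negPf ij) mulr0.
Qed.

Lemma bary_sum1 (P : pred 'I_N) j :
  bary (\sum_(i | P i) row i M) j = (P j)%:R.
Proof.
have -> : \sum_(i | P i) row i M = \sum_(i | P i) 1 *: row i M.
  by apply: eq_bigr => i _; rewrite scale1r.
by rewrite bary_sum; case: (P j).
Qed.

Lemma baryE x : x = \sum_i bary x i *: row i M.
Proof. by rewrite -mulmx_sum_row mulmxKV. Qed.

Lemma bary_inj x y : bary x =1 bary y -> x = y.
Proof.
by move=> xy; rewrite (baryE x) (baryE y); apply: eq_bigr => i _; rewrite xy.
Qed.

Lemma row_simplex i : row i M = row (g i) A.
Proof. by apply/rowP => j; rewrite !mxE. Qed.

Lemma simplex_int : M \is a mxOver Num.int.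
Proof. by apply/mxOverP => i j; rewrite mxE (mxOverP A_int). Qed.

Lemma height_simplex i : height h (row i M) = 1.
Proof. by rewrite row_simplex height_row. Qed.

Lemma height_sum_simplex (P : pred 'I_N) :
  height h (\sum_(i | P i) row i M) = #|P|%:R.
Proof.
rewrite height_sum (eq_bigr (fun=> 1)) ?sumr_const // => i _.
exact: height_simplex.
Qed.

Lemma height_bary x : height h x = \sum_i bary x i.
Proof.
rewrite {1}(baryE x) height_sum; apply: eq_bigr => i _.
by rewrite heightZ height_simplex mulr1.
Qed.

Lemma simplex_sum_int (P : pred 'I_N) :
  \sum_(i | P i) row i M \is a mxOver Num.int.
Proof. by rewrite int_mx_sum // => i _; rewrite int_mx_row ?simplex_int. Qed.

Lemma bary_cone x : (forall i, 0 <= bary x i) -> cone A x.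
Proof.
move=> x0; rewrite (baryE x); apply: (big_ind (cone A)) => [||i _].
- exact: cone0.
- exact: coneD.
- by apply: coneZ => //; rewrite row_simplex; exact: cone_row.
Qed.

(** A small multiple of the sum [a] of all rows can be subtracted without leaving the simplicial
    cone; adding it back makes all coefficients positive. *)
Lemma open_cone_bary z c :
  cone A c -> (forall i, 0 < bary (z - c) i) -> open_cone A z.
Proof.
move=> [nu nu0 cE] zc; pose a := const_mx 1 *m A : 'rV_N.
have [e e_gt0 Pe] := for_smallP (for_small_forall
  (fun i => for_small_pos (- bary a i) (zc i))).
have : cone A (z - c - e *: a).
  by apply: bary_cone => i; rewrite baryB baryZ -mulrN ltW.
move=> [mu mu0 E]; exists (mu + nu + e *: const_mx 1).
  by move=> j; rewrite !mxE mulr1 ltr_wpDl ?addr_ge0.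
by rewrite !mulmxDl -E -cE -scalemxAl -/a; apply/esym; rewrite addrAC subrK subrK.
Qed.

(** * Lattice points of the fundamental parallelepiped *)

Section BoxPoints.
Variable s : nat -> seq 'rV[R]_N.
Hypothesis sP : forall m x, x \in s m <->
  [/\ x \is a mxOver Num.int, height h x = m%:R & cone A x].

Definition box_point (x : 'rV[R]_N) : Prop :=
  x \is a mxOver Num.int /\ forall i, 0 <= bary x i < 1.

Lemma box_points_finite :
  exists F : seq 'rV[R]_N, uniq F /\ forall x, x \in F <-> box_point x.
Proof.
pose F := [seq x <- flatten [seq s m | m <- iota 0 N.+1] |
             [forall i, 0 <= bary x i < 1]].
exists (undup F); split=> [|x]; first exact: undup_uniq.
rewrite mem_undup mem_filter; split.
  move=> /andP[/forallP xb /flatten_mapP[m _ /sP[x_int _ _]]].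
  by split.
move=> [x_int xb]; apply/andP; split; first exact/forallP.
have cx : cone A x by apply: bary_cone => i; have /andP[] := xb i.
have /natrP[m hm] : height h x \is a Num.nat.
  rewrite natrEint (cone_height_ge0 Ah cx) andbT; apply: (mxOverP _).
  exact: int_mxM.
apply/flatten_mapP; exists m; last exact/sP.
rewrite mem_iota /= add0n ltnS -(ler_nat R) -hm height_bary.
have -> : N%:R = \sum_(i < N) 1 :> R by rewrite sumr_const card_ord.
by apply: ler_sum => i _; have /andP[_ /ltW] := xb i.
Qed.

Definition supp (x : 'rV[R]_N) : {set 'I_N} := [set i | bary x i != 0].

(** The complement in the sum of all simplex vertices is an interior lattice point of height
    [N - height h x]. *)
Lemma box_point_height x : box_point x -> height h x <= d%:R.
Proof.
move=> [x_int xb]; pose z := \sum_i row i M - x.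
have z_int : z \is a mxOver Num.int by rewrite int_mxB ?simplex_sum_int.
have : open_cone A z.
  apply: (@open_cone_bary z 0) => [|i]; first exact: cone0.
  by rewrite subr0 baryB bary_sum1 subr_gt0; have /andP[] := xb i.
move=> /(codegree z_int); rewrite heightB height_sum_simplex cardT size_enum_ord.
lra.
Qed.

(** Reflecting [x] within the face of its support gives another box point; the two heights add up to
    the size of the support. *)
Lemma box_point_supp x : box_point x -> (#|supp x| <= 2 * d)%N.
Proof.
move=> xb; pose x' := \sum_(i in supp x) row i M - x.
have x'b : box_point x'.
  split; first by rewrite int_mxB ?simplex_sum_int; case: xb.
  move=> i; rewrite baryB bary_sum1 inE; have [_ /(_ i)/andP[x0 x1]] := xb.
  case: eqVneq => [->|xi] /=; first by rewrite subrr lexx ltr01.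
  have : 0 < bary x i by rewrite lt_def xi.
  by move=> ?; apply/andP; lra.
have := lerD (box_point_height xb) (box_point_height x'b).
rewrite heightB height_sum_simplex addrC subrK -natrD ler_nat.
by rewrite addnn mul2n.
Qed.

(* Coordinates that take a non-integral value at some unit vector, hence those
   that are not integral on the lattice. *)
Definition nonintegral : {set 'I_N} :=
  [set i | ~~ [forall l, invmx M l i \is a Num.int]].

Lemma bary_int x i : x \is a mxOver Num.int -> i \notin nonintegral ->
  bary x i \is a Num.int.
Proof.
move=> x_int; rewrite inE negbK => /forallP Mi.
by rewrite /bary mxE rpred_sum // => l _; rewrite rpredM // (mxOverP x_int).
Qed.

Definition frac (x : 'rV[R]_N) : 'rV[R]_N :=
  x - \sum_i (Num.floor (bary x i))%:~R *: row i M.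

Lemma bary_frac x i : bary (frac x) i = bary x i - (Num.floor (bary x i))%:~R.
Proof. by rewrite baryB bary_sum. Qed.

Lemma frac_box x : x \is a mxOver Num.int -> box_point (frac x).
Proof.
move=> x_int; split.
  rewrite int_mxB // int_mx_sum // => i _.
  by rewrite int_mxZ ?intr_int ?int_mx_row ?simplex_int.
move=> i; rewrite bary_frac subr_ge0 floor_le /=.
by have := floorD1_gt (bary x i); rewrite intrD mulr1z; lra.
Qed.

(* Translating by a lattice point with non-integral i-th coordinate maps the
   box points with vanishing i-th coordinate injectively to the others. *)
Lemma nonintegral_count F i : uniq F -> (forall x, x \in F <-> box_point x) ->
  i \in nonintegral ->
  (size F <= 2 * count (fun x => bary x i != 0%R) F)%N.
Proof.
move=> F_uniq FP; rewrite inE => /forallPn[l Mli].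
pose x0 : 'rV[R]_N := delta_mx 0 l.
have x0_int : x0 \is a mxOver Num.int.
  by apply/mxOverP => a b; rewrite mxE natr_int.
have x0i : bary x0 i \isn't a Num.int by rewrite /bary /x0 -rowE mxE.
pose T x := frac (x + x0).
rewrite -(count_predC (fun x => bary x i != 0) F) mul2n -addnn leq_add2l.
rewrite -!size_filter -(size_map T) uniq_leq_size //.
  rewrite map_inj_in_uniq ?filter_uniq // => x x'.
  rewrite !mem_filter => /andP[_ /FP[_ xb]] /andP[_ /FP[_ xb']] Txx'.
  apply: bary_inj => j; have := congr1 (bary ^~ j) Txx'.
  rewrite !bary_frac !baryD => E.
  have xx'_int : bary x j - bary x' j \is a Num.int.
    have -> : bary x j - bary x' j =
      (Num.floor (bary x j + bary x0 j) - Num.floor (bary x' j + bary x0 j))%:~R.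
      by rewrite intrB; lra.
    exact: intr_int.
  have [//|xx'] := eqVneq (bary x j) (bary x' j).
  rewrite -subr_eq0 in xx'; have := norm_intr_ge1 xx'_int xx'.
  move: (xb j) (xb' j) => /andP[? ?] /andP[? ?].
  have : `|bary x j - bary x' j| < 1 by rewrite ltr_norml; apply/andP; lra.
  by rewrite ltNge => /negPf ->.
move=> _ /mapP[x + ->]; rewrite !mem_filter /= negbK => /andP[/eqP xi /FP[x_int _]].
apply/andP; split; last by apply/FP; apply: frac_box; rewrite int_mxD.
rewrite bary_frac baryD xi add0r subr_eq0; apply: contra x0i => /eqP ->.
exact: intr_int.
Qed.

(** Pairs of a box point and a nonzero coordinate are counted twice: each nonintegral coordinate is
    nonzero on at least half of [F], and each point has at most [2 * d] nonzero coordinates. The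
    point 0 has none, which makes the bound strict. *)
Lemma nonintegral_card : (0 < d)%N -> (#|nonintegral| < 4 * d)%N.
Proof.
move=> d_gt0; have [F [F_uniq FP]] := box_points_finite.
have F0 : 0 \in F.
  apply/FP; split; first by apply/mxOverP => a b; rewrite mxE.
  by move=> i; rewrite bary0 lexx ltr01.
have supp0 : #|supp 0| = 0%N.
  by apply/eqP; rewrite cards_eq0; apply/eqP/setP => i; rewrite !inE bary0 eqxx.
have le1 : (#|nonintegral| * size F <= 2 * \sum_(x <- F) #|supp x|)%N.
  rewrite -sum_nat_const.
  have : (\sum_(i in nonintegral) size F <= \sum_(i in nonintegral)
      2 * count (fun x => bary x i != 0%R) F)%N.
    by apply: leq_sum => i iU; exact: nonintegral_count.
  move=> /leq_trans; apply; rewrite -big_distrr /= leq_mul2l /=.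
  under eq_bigr => i _ do rewrite -sum1_count big_mkcond.
  rewrite exchange_big /=; apply: leq_sum => x _.
  rewrite -sum1_card [leqRHS]big_mkcond [leqLHS]big_mkcond /=.
  by apply: leq_sum => i _; rewrite [in leqRHS]inE; case: ifP.
have le2 : (\sum_(x <- F) #|supp x| <= 2 * d * (size F).-1)%N.
  rewrite (perm_big _ (perm_to_rem F0)) big_cons supp0 [leqLHS]add0n.
  rewrite -(size_rem F0).
  have : forall x, x \in rem 0 F -> (#|supp x| <= 2 * d)%N.
    by move=> x /mem_rem/FP/box_point_supp.
  elim: (rem 0 F) => [|x r IHr] rle; first by rewrite big_nil.
  rewrite big_cons mulnS leq_add ?rle ?mem_head // IHr // => x' x'r.
  by rewrite rle // inE x'r orbT.
have F_gt0 : (0 < size F)%N by case: (F) F0.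
rewrite -(ltn_pmul2r F_gt0); nia.
Qed.

End BoxPoints.
(* Adding the vertices outside U to z gives an interior lattice point whose
   height is smaller than that of the sum of all vertices by at least e. *)
Definition covered (U : {set 'I_N}) (e : nat) : Prop :=
  exists z c, [/\ z \is a mxOver Num.int, height h z + e%:R <= #|U|%:R, cone A c,
    forall i, i \in U -> 0 < bary (z - c) i
  & forall i, 0 <= bary (z - c) i].

Lemma covered_le U e : covered U e -> (e <= d)%N.
Proof.
move=> [z [c [z_int hz cc zcU zc]]]; pose z' := z + \sum_(i | i \notin U) row i M.
have z'_int : z' \is a mxOver Num.int by rewrite int_mxD ?simplex_sum_int.
have : open_cone A z'.
  apply: (open_cone_bary cc) => i; rewrite addrAC baryD bary_sum1.
  have [iU|iU] := boolP (i \in U); first by rewrite addr0 zcU.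
  by rewrite ltr_wpDl ?zc.
move=> /(codegree z'_int); rewrite heightD height_sum_simplex -(ler_nat R).
have -> : N%:R = #|U|%:R + #|[predC U]|%:R :> R by rewrite -natrD cardC card_ord.
lra.
Qed.

Lemma covered_nonintegral : covered nonintegral 0.
Proof.
exists (\sum_(i in nonintegral) row i M), 0; split.
- exact: simplex_sum_int.
- by rewrite height_sum_simplex addr0.
- exact: cone0.
- by move=> i iU; rewrite subr0 bary_sum1 iU.
- by move=> i; rewrite subr0 bary_sum1 ler0n.
Qed.

(** Once [U] contains [nonintegral], the other rows are those whose coordinates outside [U] form 0
    or a unit vector. *)
Definition bad_row (U : {set 'I_N}) (j : 'I_k) : bool :=
  [exists i, (i \notin U) && (bary (row j A) i < 0)] ||
  (1 < \sum_(i | i \notin U) bary (row j A) i).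

Hypothesis bary_le1 : forall j i, `|bary (row j A) i| <= 1.

(* With P and Q the coordinates outside U where w is positive and negative,
   either the vertices of Q or all but one of the vertices of P become
   redundant for an interior point once w is available. *)
Lemma covered_step U e j : covered U e -> bad_row U j ->
  exists (U' : {set 'I_N}) f, [/\ U \subset U', (0 < f)%N, (#|U'| <= #|U| + 3 * f)%N
    & covered U' (e + f)].
Proof.
move=> [z [c [z_int hz cc zcU zc]]] bad; set w := row j A in bad *.
set v := z - c in zcU zc.
have w_int : w \is a mxOver Num.int by rewrite int_mx_row.
have w_le i : -1 <= bary w i <= 1 by rewrite -ler_norml bary_le1.
pose P := [set i | (i \notin U) && (0 < bary w i)].
pose Q := [set i | (i \notin U) && (bary w i < 0)].
have cardU' : #|U :|: P :|: Q| = (#|U| + #|P| + #|Q|)%N.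
  rewrite !cardsU.
  have -> : U :&: P = set0.
    by apply/setP => i; rewrite !inE; case: (i \in U).
  have -> : (U :|: P) :&: Q = set0.
    apply/setP => i; rewrite !inE; case: (i \in U) => //=.
    by case: ltgtP.
  by rewrite !cards0 !subn0.
have [t t_gt0 [t_lt1 tU]] : exists2 t : R, 0 < t & (0 < 1 + t * -1) /\
    forall i, i \in U -> 0 < bary v i + t * bary w i /\
                       0 < bary v i + t * - bary w i.
  apply: for_smallP; apply: for_small_and; first exact: for_small_pos.
  apply: for_small_forall => i; have [iU|iU] := boolP (i \in U); last first.
    exact: for_small_all.
  have [e0 e0_gt0 H] := for_small_and (for_small_pos (bary w i) (zcU i iU))
    (for_small_pos (- bary w i) (zcU i iU)).
  by exists e0 => // e1 e1_gt0 le_e1 _; exact: H.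
have t_lt1' : t < 1 by lra.
have outU i : i \notin U -> (i \in P) = (0 < bary w i) /\ (i \in Q) = (bary w i < 0).
  by move=> iU; rewrite !inE iU.
have inU i : i \in U -> (i \in P) = false /\ (i \in Q) = false.
  by move=> iU; rewrite !inE iU.
have inU' i : i \in U :|: P :|: Q -> [|| i \in U, i \in P | i \in Q].
  by rewrite !inE orbA.
have sub : U \subset U :|: P :|: Q by rewrite -setUA subsetUl.
have cw : cone A w by exact: cone_row.
(* The gain [f] is [#|Q|] in the first case and [#|P| - 1] in the second; both give
   [#|P| + #|Q| <= 3 * f]. *)
have [PQ|PQ] := leqP #|P| #|Q|.+1.
  (* With [Q] empty, at most one coordinate outside [U] would be positive, and it is at most 1, so
     the row would not be bad. *)
  have Q_gt0 : (0 < #|Q|)%N.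
    rewrite lt0n cards_eq0; apply/negP => /eqP Q0.
    have P1 : (#|P| <= 1)%N by rewrite Q0 cards0 in PQ.
    move: bad => /orP[/existsP[i /andP[iU wi]]|].
      by have := in_set0 i; rewrite -Q0 !inE iU wi.
    rewrite ltNge; apply/negP; rewrite negbK.
    rewrite (bigID (mem P)) /= [X in _ + X <= _](_ : _ = 0); last first.
      apply: big1 => i /andP[iU iP]; have [PE QE] := outU i iU.
      apply/eqP; rewrite eq_le !leNgt -PE -QE iP Q0 inE.
      by [].
    rewrite addr0; apply: le_trans (_ : \sum_(i in P) 1 <= 1).
      rewrite [leLHS](eq_bigl (mem P)); last first.
        by move=> i; rewrite /= !inE; case: (i \in U).
      by apply: ler_sum => i _; have /andP[] := w_le i.
    by rewrite sumr_const lern1.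
  exists (U :|: P :|: Q), #|Q|; split=> //.
    by clear -cardU' PQ Q_gt0; lia.
  (* Subtracting [t *: w] makes the coordinates in [Q] positive; the vertices of [P] compensate for
     it, as [t < 1]. *)
  exists (z + \sum_(i in P) row i M), (c + t *: w); split.
  - by rewrite int_mxD ?simplex_sum_int.
  - rewrite heightD height_sum_simplex cardU' !natrD; lra.
  - by apply: coneD => //; apply: coneZ => //; exact: ltW.
  - move=> i /inU'; rewrite opprD addrACA -/v baryD [bary (_ - t *: w) i]baryB bary_sum1 baryZ.
    have := zc i; have := w_le i.
    have [iU|iU] := boolP (i \in U).
      by have [-> ->] := inU i iU; have [_] := tU i iU; rewrite /=; lra.
    have [-> ->] := outU i iU.
    by case: ltgtP => //= wi; nra.
  - move=> i; rewrite opprD addrACA -/v baryD [bary (_ - t *: w) i]baryB bary_sum1 baryZ.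
    have := zc i; have := w_le i.
    have [iU|iU] := boolP (i \in U).
      by have [-> _] := inU i iU; have [_] := tU i iU; rewrite /=; lra.
    have [-> _] := outU i iU.
    by case: ltgtP => //= wi; nra.
have P_gt0 : (0 < #|P|)%N by exact: leq_trans PQ.
exists (U :|: P :|: Q), #|P|.-1; split=> //.
- by clear -PQ; lia.
- by clear -cardU' PQ; lia.
(* Now [w] is added at height 1. All but [t *: w] goes to the cone part; this remainder makes [P]
   positive, and the vertices of [Q] compensate. *)
exists (z + w + \sum_(i in Q) row i M), (c + (1 - t) *: w).
have E : z + w + \sum_(i in Q) row i M - (c + (1 - t) *: w) =
    v + t *: w + \sum_(i in Q) row i M.
  rewrite /v scalerBl scale1r; move: (\sum_(i in Q) _) (t *: w) => q tw.
  apply/rowP => i; rewrite !mxE; lra.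
split.
- by rewrite !int_mxD ?simplex_sum_int.
- rewrite !heightD height_sum_simplex /w height_row // cardU' !natrD.
  have -> : #|P|%:R = #|P|.-1%:R + 1 :> R by rewrite natr1 prednK.
  lra.
- by apply: coneD => //; apply: coneZ => //; lra.
- move=> i /inU'; rewrite E baryD [bary (v + _) i]baryD bary_sum1 baryZ.
  have := zc i; have := w_le i.
  have [iU|iU] := boolP (i \in U).
    by have [-> ->] := inU i iU; have [] := tU i iU; rewrite /=; lra.
  have [-> ->] := outU i iU.
  by case: ltgtP => //= wi; nra.
- move=> i; rewrite E baryD [bary (v + _) i]baryD bary_sum1 baryZ.
  have := zc i; have := w_le i.
  have [iU|iU] := boolP (i \in U).
    by have [_ ->] := inU i iU; have [] := tU i iU; rewrite /=; lra.
  have [_ ->] := outU i iU.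
  by case: ltgtP => //= wi; nra.
Qed.

(** Each step spends at most three elements per unit of [e], and [e] never exceeds [d]. *)
Lemma no_bad_rows : exists U : {set 'I_N},
  [/\ nonintegral \subset U, (#|U| <= #|nonintegral| + 3 * d)%N
    & forall j, ~~ bad_row U j].
Proof.
suff main e U : covered U e -> nonintegral \subset U ->
    (#|U| + 3 * (d - e) <= #|nonintegral| + 3 * d)%N ->
    exists U' : {set 'I_N}, [/\ nonintegral \subset U',
      (#|U'| <= #|nonintegral| + 3 * d)%N & forall j, ~~ bad_row U' j].
  by apply: (main 0%N nonintegral covered_nonintegral) => //; rewrite subn0.
have [m le_m] := ubnP (d - e); elim: m e U le_m => // m IH e U le_m cU sU leU.
have [/forallP ok|/forallPn[j]] := boolP [forall j, ~~ bad_row U j].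
  by exists U; split=> //; lia.
rewrite negbK => /(covered_step cU)[U' [f [UU' f_gt0 cardU' cU']]].
have := covered_le cU' => le_d.
by apply: (IH (e + f)%N U') => //; [lia|exact: subset_trans UU'|lia].
Qed.

End Simplex.

(** * Cayley decompositions *)

(** In the Smith normal form [C = L S T], the last [q] columns of [L] complete the columns of [C] to
    a lattice basis. *)
Lemma int_unimodular_completion q s (C : 'M[int]_(q + s, s)) (D : 'M[int]_(s, q + s)) :
  D *m C = 1%:M ->
  exists B B' : 'M[int]_(q + s), [/\ B *m B' = 1%:M, B' *m B = 1%:M & rsubmx B = C].
Proof.
move=> DC; have [L uL [T uT [e _ CE]]] := int_Smith_normal_form C.
set S := \matrix_(i, j) _ in CE.
pose X := T *m D *m L.
have XS : X *m S = 1%:M.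
  have : T *m (D *m C) *m invmx T = 1%:M by rewrite DC mulmx1 mulmxV.
  by rewrite CE !mulmxA mulmxK.
(* [K] selects the last [q] coordinates, where [S] has zero rows. Cutting [X] to its first [s]
   columns keeps it a left inverse of [S] and makes it annihilate [K]. *)
pose K : 'M[int]_(q + s, q) := \matrix_(i, j) ((i == s + j :> nat)%:R).
pose Z : 'M[int]_(s, q + s) := \matrix_(i, j) (if (j < s)%N then X i j else 0).
have ZS : Z *m S = 1%:M.
  rewrite -XS; apply/matrixP => i j; rewrite !mxE; apply: eq_bigr => l _.
  rewrite !mxE; case: ltnP => // sl; rewrite mul0r.
  case: eqP => [lj|]; last by rewrite mulr0.
  by have := ltn_ord j; rewrite -lj ltnNge sl.
have ZK : Z *m K = 0.
  apply/matrixP => i j; rewrite !mxE big1 // => l _; rewrite !mxE.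
  case: ltnP => ls; last by rewrite mul0r.
  by case: eqP => [ls'|]; rewrite ?mulr0 //; move: ls; rewrite ls' ltnNge leq_addr.
have KK : K^T *m K = 1%:M.
  apply/matrixP => i j; rewrite !mxE.
  have si : (s + i < q + s)%N by rewrite addnC ltn_add2r.
  rewrite (bigD1 (Ordinal si)) //= big1 ?addr0 => [|l li].
    by rewrite !mxE /= eqxx mul1r eqn_add2l.
  rewrite !mxE; case: eqP => [ls|]; last by rewrite mul0r.
  by case/eqP: li; apply: val_inj.
have KS : K^T *m S = 0.
  apply/matrixP => i j; rewrite !mxE big1 // => l _; rewrite !mxE.
  case: eqP => [ls|]; last by rewrite mul0r.
  case: eqP => [lj|]; last by rewrite mulr0.
  by have := ltn_ord j; rewrite -lj ls ltnNge leq_addr.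
pose B := row_mx (L *m K) C.
pose B' := col_mx (K^T *m invmx L) (invmx T *m Z *m invmx L).
have B'B : B' *m B = 1%:M.
  rewrite mul_col_row scalar_mx_block; congr block_mx.
  - by rewrite -mulmxA (mulKmx uL).
  - by rewrite CE -!mulmxA (mulKmx uL) mulmxA KS mul0mx.
  - by rewrite -!mulmxA (mulKmx uL) ZK mulmx0.
  - by rewrite CE -!mulmxA (mulKmx uL) (mulmxA Z) ZS mul1mx mulVmx.
by exists B, B'; split; [exact: mulmx1C| |exact: row_mxKr].
Qed.

Lemma unimodular_completion (R : realType) (n q s : nat) (C : 'M[R]_(n, s))
    (D : 'M[R]_(s, n)) :
  n = (q + s)%N -> C \is a mxOver Num.int -> D \is a mxOver Num.int ->
  D *m C = 1%:M ->
  exists (B : 'M[R]_(n, q + s)) (B' : 'M[R]_(q + s, n)),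
    [/\ B \is a mxOver Num.int /\ B' \is a mxOver Num.int,
        B *m B' = 1%:M, B' *m B = 1%:M & rsubmx B = C].
Proof.
move=> nE; subst n => C_int D_int DC.
pose fl m p (X : 'M[R]_(m, p)) : 'M[int]_(m, p) := map_mx Num.floor X.
pose inj m p (X : 'M[int]_(m, p)) : 'M[R]_(m, p) := map_mx intr X.
have flK m p (X : 'M[R]_(m, p)) : X \is a mxOver Num.int -> inj _ _ (fl _ _ X) = X.
  by move=> /mxOverP X_int; apply/matrixP => i j; rewrite !mxE floorK.
have inj_int m p (X : 'M[int]_(m, p)) : inj _ _ X \is a mxOver Num.int.
  by apply/mxOverP => i j; rewrite mxE intr_int.
have inj1 m : inj m m 1%:M = 1%:M by rewrite /inj map_mx1.
have DC' : fl _ _ D *m fl _ _ C = 1%:M.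
  have E : inj _ _ (fl _ _ D *m fl _ _ C) = inj _ _ 1%:M.
    by rewrite inj1 /inj map_mxM -/(inj _ _ (fl _ _ D)) -/(inj _ _ (fl _ _ C)) !flK.
  apply/matrixP => i j; have /matrixP/(_ i j) := E.
  by rewrite [LHS]mxE [RHS]mxE => /intr_inj.
have [B [B' [BB' B'B BC]]] := int_unimodular_completion DC'.
exists (inj _ _ B), (inj _ _ B'); split.
- by split; exact: inj_int.
- by rewrite -map_mxM BB' map_mx1.
- by rewrite -map_mxM B'B map_mx1.
- by rewrite -(flK _ _ _ C_int) -BC /inj map_rsubmx.
Qed.

(* By Cramer's rule, for a minor of maximal absolute value. *)
Lemma max_minor (R : realFieldType) (k N : nat) (A : 'M[R]_(k, N)) :
  \rank A = N ->
  exists2 g : 'I_N -> 'I_k, rowsub g A \in unitmx &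
    forall j i, `|(row j A *m invmx (rowsub g A)) 0 i| <= 1.
Proof.
move=> rA; have fA : row_full A by rewrite /row_full rA.
pose F (g : {ffun 'I_N -> 'I_k}) := `|\det (rowsub g A)|.
have [g _ maxg] := Order.TotalTheory.arg_maxP F (isT : xpredT (fullrankfun fA)).
set M := rowsub g A in maxg *; have uM : M \in unitmx.
  rewrite unitmxE unitfE -normr_gt0 (lt_le_trans _ (maxg (fullrankfun fA) isT)) //.
  by rewrite normr_gt0 -unitfE -unitmxE fullrowsub_unit.
exists g => // j i; set c := row j A *m invmx M.
pose E : 'M[R]_N := \matrix_(l, m) if l == i then c 0 m else (l == m)%:R.
have detE : \det E = c 0 i.
  rewrite (expand_det_col _ i) (bigD1 i) //= big1 ?addr0 => [|l li].
    rewrite /cofactor (_ : row' i (col' i E) = 1%:M).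
      by rewrite det1 mulr1 addnn -signr_odd odd_double mulr1 mxE eqxx.
    apply/matrixP => a b; rewrite !mxE eq_sym (negPf (neq_lift _ _)).
    by rewrite (inj_eq lift_inj).
  by rewrite mxE (negPf li) mul0r.
(* This exchange multiplies the determinant by [c 0 i]. *)
pose g' := [ffun l => if l == i then j else g l].
have EM : rowsub g' A = E *m M.
  apply/row_matrixP => l; rewrite row_mul.
  have -> : row l (rowsub g' A) = row (g' l) A by apply/rowP => m; rewrite !mxE.
  rewrite ffunE; have [li|li] := eqVneq l i.
    have -> : row l E = c by apply/rowP => m; rewrite !mxE li eqxx.
    by rewrite mulmxKV.
  have -> : row l E = delta_mx 0 l.
    by apply/rowP => m; rewrite !mxE (negPf li) eqxx [m == l]eq_sym.
  by rewrite -rowE; apply/rowP => m; rewrite !mxE.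
have := maxg g' isT; rewrite /F EM det_mulmx detE normrM -/M /=.
by rewrite ger_pMl // normr_gt0 -unitfE -unitmxE.
Qed.

(** * Homogenization of a lattice polytope *)

Section Polytope.
Variables (R : realType) (n : nat) (V : seq 'rV[R]_n).

Definition vertex_mx : 'M[R]_(size V, n) := \matrix_i V`_i.

Lemma polytopeP x : polytope V x <->
  exists w : 'rV[R]_(size V),
    [/\ forall j, 0 <= w 0 j, \sum_j w 0 j = 1 & x = w *m vertex_mx].
Proof.
split=> [[k [p [w [pV w0 w1 ->]]]]|[w [w0 w1 ->]]]; last first.
  exists (size V), (fun i => V`_i), (w 0); split=> // [i|].
    exact: mem_nth.
  by rewrite mulmx_sum_row; apply: eq_bigr => i _; rewrite rowK.
have pi i : (index (p i) V < size V)%N by rewrite index_mem pV.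
pose f i := Ordinal (pi i).
exists (\row_j \sum_(i | f i == j) w i); split.
- by move=> j; rewrite mxE sumr_ge0.
- rewrite -w1 (partition_big f xpredT) //=.
  by apply: eq_bigr => j _; rewrite mxE.
- rewrite mulmx_sum_row (partition_big f xpredT) //=; apply: eq_bigr => j _.
  rewrite mxE scaler_suml; apply: eq_bigr => i /eqP <-.
  by rewrite rowK nth_index // pV.
Qed.

Lemma polytope_mem v : v \in V -> polytope V v.
Proof.
move=> vV; exists 1%N, (fun=> v), (fun=> 1); split=> //.
- by rewrite big_ord1.
- by rewrite big_ord1 scale1r.
Qed.

Lemma polytope_convex k (p : 'I_k -> 'rV[R]_n) (w : 'I_k -> R) :
  (forall i, polytope V (p i)) -> (forall i, 0 <= w i) -> \sum_i w i = 1 ->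
  polytope V (\sum_i w i *: p i).
Proof.
move=> pV w0 w1.
have [u Pu] := choice (fun i => (polytopeP (p i)).1 (pV i)).
apply/polytopeP; exists (\sum_i w i *: u i); split.
- move=> j; rewrite summxE sumr_ge0 // => i _.
  by rewrite mxE mulr_ge0 //; have [] := Pu i.
- rewrite -w1; under eq_bigr do rewrite summxE.
  rewrite exchange_big /=; apply: eq_bigr => i _.
  under eq_bigr do rewrite mxE.
  by rewrite -mulr_sumr; have [_ -> _] := Pu i; rewrite mulr1.
- rewrite mulmx_suml; apply: eq_bigr => i _.
  by rewrite -scalemxAl; have [_ _ <-] := Pu i.
Qed.

Definition lift_pt (m : nat) (x : 'rV[R]_n) : 'rV[R]_(1 + n) :=
  row_mx (const_mx m%:R) x.

Definition lift_mx : 'M[R]_(size V, 1 + n) := row_mx (const_mx 1) vertex_mx.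

Definition lift_height : 'cV[R]_(1 + n) := col_mx 1%:M 0.

Lemma lift_mx_height : lift_mx *m lift_height = const_mx 1.
Proof. by rewrite mul_row_col mulmx1 mulmx0 addr0. Qed.

Lemma row_lift_mx i : row i lift_mx = lift_pt 1 V`_i.
Proof.
by rewrite row_row_mx row_const rowK.
Qed.

Lemma lattice_ptP (x : 'rV[R]_n) : lattice_pt x <-> x \is a mxOver Num.int.
Proof.
split=> [x_int|/mxOverP x_int i]; last exact: x_int.
by apply/mxOverP => a b; rewrite ord1.
Qed.

Lemma lift_pt_int m x : lift_pt m x \is a mxOver Num.int <-> x \is a mxOver Num.int.
Proof.
split=> /mxOverP x_int; apply/mxOverP => a b.
  by have := x_int a (rshift 1 b); rewrite row_mxEr.
by rewrite !mxE; case: split => c //; rewrite mxE natr_int.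
Qed.

Lemma height_lift_pt m x : height lift_height (lift_pt m x) = m%:R.
Proof. by rewrite /height mul_row_col mulmx1 mulmx0 addr0 mxE. Qed.

Lemma lift_height_int : lift_height \is a mxOver Num.int.
Proof.
apply/mxOverP => a b; rewrite !mxE; case: split => c; rewrite !mxE ?rpred0 //.
Qed.

Lemma lift_mx_int : is_lattice_list V -> lift_mx \is a mxOver Num.int.
Proof.
move=> [_ V_int]; apply/mxOverP => a b; rewrite !mxE; case: split => c.
  by rewrite mxE rpred1.
by rewrite mxE; apply: V_int; rewrite mem_nth.
Qed.

Lemma lift_pt_inj m : injective (lift_pt m).
Proof. by move=> x y /eq_row_mx[]. Qed.

Lemma cone_lift_mx (x : 'rV[R]_(1 + n)) m : V != [::] ->
  height lift_height x = m%:R -> cone lift_mx x ->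
  exists2 z, dilate m (polytope V) z & x = lift_pt m z.
Proof.
move=> V0 hx [mu mu0 xE].
have sum_mu : \sum_j mu 0 j = m%:R.
  by rewrite -hx xE (height_mul lift_mx_height).
exists (mu *m vertex_mx); last first.
  rewrite xE /lift_mx mul_mx_row; congr row_mx; apply/rowP => i.
  by rewrite !mxE -sum_mu; apply: eq_bigr => j _; rewrite mxE mulr1.
(* At height 0 all coefficients vanish, and any vertex serves as the point to dilate by 0. *)
have [m0|m_gt0] := posnP m.
  exists V`_0.
    by apply: polytope_mem; rewrite mem_nth // lt0n size_eq0.
  rewrite m0 scale0r (_ : mu = 0) ?mul0mx //; apply/rowP => j; rewrite mxE.
  have s0 : \sum_j mu 0 j = 0 by rewrite sum_mu m0.
  exact: (psumr_eq0P (fun i _ => mu0 i) s0).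
have m0 : m%:R != 0 :> R by rewrite pnatr_eq0 -lt0n.
exists (m%:R^-1 *: mu *m vertex_mx).
  apply/polytopeP; exists (m%:R^-1 *: mu); split=> //.
    by move=> j; rewrite mxE mulr_ge0 // invr_ge0.
  by under eq_bigr do rewrite mxE; rewrite -mulr_sumr sum_mu mulVf.
by rewrite -scalemxAl scalerA divff // scale1r.
Qed.

Lemma dilate_cone m z :
  dilate m (polytope V) z -> cone lift_mx (lift_pt m z).
Proof.
move=> [y /polytopeP[w [w0 w1 ->]] ->]; exists (m%:R *: w).
  by move=> j; rewrite mxE mulr_ge0.
rewrite /lift_mx mul_mx_row -!scalemxAl; congr row_mx; apply/rowP => i.
rewrite !mxE; under eq_bigr do rewrite mxE mulr1.
by rewrite w1 mulr1.
Qed.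

(** Differences of lifted vertices have first coordinate 0 and span the rest; one lifted vertex
    supplies the missing direction. *)
Lemma lift_mx_rank : V != [::] -> full_dim V -> \rank lift_mx = (1 + n)%N.
Proof.
move=> V0; rewrite /full_dim; set D := \matrix_(i < _) _ => rD.
have /row_fullP[L LD] : row_full D by rewrite /row_full rD.
have V_gt0 : (0 < size V)%N by rewrite lt0n size_eq0.
pose i0 := Ordinal V_gt0.
pose X := L *m (1%:M - \matrix_i (delta_mx 0 i0 : 'rV_(size V))).
have XA : X *m lift_mx = row_mx 0 1%:M.
  have -> : row_mx 0 1%:M = L *m row_mx 0 D :> 'M_(n, 1 + n).
    by rewrite mul_mx_row mulmx0 LD.
  rewrite -mulmxA mulmxBl mul1mx; congr (_ *m _).
  apply/row_matrixP => i; rewrite row_row_mx row0 rowK linearB /= row_mul rowK.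
  rewrite -rowE !row_lift_mx /lift_pt opp_row_mx add_row_mx; congr row_mx.
  by rewrite subrr.
apply/eqP; apply/row_fullP.
exists (col_mx (delta_mx 0 i0 - V`_0 *m X) X).
rewrite mul_col_mx XA mulmxBl -mulmxA XA -rowE row_lift_mx mul_mx_row mulmx0 mulmx1.
rewrite opp_row_mx add_row_mx subrr oppr0 addr0 scalar_mx_block block_mxEv.
congr (col_mx (row_mx _ _) _); apply/matrixP => a b.
by rewrite !ord1 !mxE.
Qed.

Lemma lattice_points_lift (L : nat -> nat) : V != [::] ->
  (forall m, lattice_count (dilate m (polytope V)) (L m)) ->
  exists s : nat -> seq 'rV[R]_(1 + n),
    [/\ forall m, uniq (s m),
        forall m x, x \in s m <-> [/\ x \is a mxOver Num.int,
          height lift_height x = m%:R & cone lift_mx x]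
      & forall m, size (s m) = L m].
Proof.
move=> V0 /choice[s Ps]; exists (fun m => map (lift_pt m) (s m)); split.
- by move=> m; rewrite map_inj_uniq; [have [] := Ps m|exact: lift_pt_inj].
- move=> m x; have [_ sP _] := Ps m; split.
    move=> /mapP[y /sP[/lattice_ptP y_int yP] ->]; split.
    + exact/lift_pt_int.
    + exact: height_lift_pt.
    + exact: dilate_cone.
  move=> [x_int xh /(cone_lift_mx V0 xh)[y yP xE]]; apply/mapP; exists y => //.
  by apply/sP; split=> //; apply/lattice_ptP/(lift_pt_int m); rewrite -xE.
- by move=> m; rewrite size_map; have [_ _ ->] := Ps m.
Qed.

Lemma codegree_lift d z : is_lattice_list V -> full_dim V ->
  has_degree (polytope V) d -> z \is a mxOver Num.int -> open_cone lift_mx z ->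
  (1 + n)%:R <= d%:R + height lift_height z.
Proof.
move=> Vlat Vfull [L [Lcount _ Lvanish]]; have V0 : V != [::] by case: Vlat.
have [s [s_uniq sP s_size]] := lattice_points_lift V0 Lcount.
apply: (open_cone_height lift_mx_height (lift_mx_int Vlat) lift_height_int
  (lift_mx_rank V0 Vfull) s_uniq sP).
move=> j /Lvanish; rewrite hstar_coefE => <-.
by apply: eq_iter_bdiff => m; rewrite s_size.
Qed.

End Polytope.

Lemma affine_comb (R : realType) n p (B : 'M[R]_(n, p)) (b : 'rV[R]_p) k
    (w : 'I_k -> R) (x : 'I_k -> 'rV[R]_n) :
  \sum_i w i = 1 ->
  (\sum_i w i *: x i) *m B + b = \sum_i w i *: (x i *m B + b).
Proof.
move=> w1; under [RHS]eq_bigr do rewrite scalerDr.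
rewrite big_split /= -scaler_suml w1 scale1r mulmx_suml; congr (_ + _).
by apply: eq_bigr => i _; rewrite scalemxAl.
Qed.

(* An affine lattice isomorphism whose last coordinates map every vertex to a
   vertex of the standard simplex, each one being hit, is a Cayley
   decomposition. *)
Lemma cayley_of_simplex_map (R : realType) (n q s : nat) (V : seq 'rV[R]_n)
    (B : 'M[R]_(n, q + s)) (B' : 'M[R]_(q + s, n)) (b : 'rV[R]_(q + s)) :
  (forall v, v \in V -> lattice_pt v) ->
  B \is a mxOver Num.int -> B' \is a mxOver Num.int ->
  b \is a mxOver Num.int -> B *m B' = 1%:M -> B' *m B = 1%:M ->
  (forall v, v \in V -> exists i, rsubmx (v *m B + b) = cay_e R i) ->
  (forall i : 'I_s.+1, exists2 v, v \in V & rsubmx (v *m B + b) = cay_e R i) ->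
  cayley_decomposes q (polytope V).
Proof.
move=> V_int B_int B'_int b_int BB' B'B Vcay cayV.
pose f (x : 'rV[R]_n) := x *m B + b.
have f_int x : x \is a mxOver Num.int -> f x \is a mxOver Num.int.
  by move=> x_int; rewrite int_mxD ?int_mxM.
pose f' (y : 'rV[R]_(q + s)) := (y - b) *m B'.
have fK : cancel f f' by move=> x; rewrite /f' /f addrK -mulmxA BB' mulmx1.
have f'K : cancel f' f by move=> y; rewrite /f' /f -mulmxA B'B mulmx1 subrK.
pose Vs (i : 'I_s.+1) :=
  [seq lsubmx (f v) | v <- V & rsubmx (f v) == cay_e R i].
have fE v i : rsubmx (f v) = cay_e R i -> f v = row_mx (lsubmx (f v)) (cay_e R i).
  by move=> <-; rewrite hsubmxK.
exists s, B, b, Vs; split.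
- by exists f'.
- move=> x; rewrite !lattice_ptP -/(f x); split; first exact: f_int.
  by move=> fx_int; rewrite -(fK x) int_mxM // int_mxB.
- move=> i; split.
    have [v vV vi] := cayV i; apply/negP => /eqP Vi0.
    suff : lsubmx (f v) \in Vs i by rewrite Vi0.
    by apply/mapP; exists v; rewrite // mem_filter vi eqxx.
  move=> z /mapP[v]; rewrite mem_filter => /andP[_ vV] ->; apply/lattice_ptP.
  have /f_int/mxOverP fv_int := (lattice_ptP v).1 (V_int v vV).
  by apply/mxOverP => a c; rewrite mxE.
- move=> y; split.
    move=> [x [k [p [w [pV w0 w1 ->]]]] <-]; rewrite affine_comb //.
    exists k, (f \o p), w; split=> //= j; have [i pji] := Vcay _ (pV j).
    exists i, (lsubmx (f (p j))); last exact: fE.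
    apply: polytope_mem; apply/mapP; exists (p j) => //.
    by rewrite mem_filter pV; apply/andP; split=> //; apply/eqP.
  move=> [k [p [w [pP w0 w1 ->]]]].
  (* A generator over [cay_e R i] combines projections of vertices; the same weights on the vertices
     give its preimage. *)
  have /choice[x Px] j : exists x, polytope V x /\ f x = p j.
    have [i [x' [m [t [u [tV u0 u1 ->]]]] ->]] := pP j.
    have /choice[v Pv] l : exists v, [/\ v \in V, rsubmx (f v) = cay_e R i
        & lsubmx (f v) = t l].
      have /mapP[v] := tV l; rewrite mem_filter => /andP[/eqP vi vV ->].
      by exists v.
    exists (\sum_l u l *: v l); split.
      by apply: polytope_convex => // l; apply: polytope_mem; have [] := Pv l.
    rewrite /f affine_comb // -[LHS]hsubmxK !linear_sum -[cay_e R i]scale1r -u1.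
    rewrite scaler_suml; congr row_mx; apply: eq_bigr => l _; rewrite linearZ /=.
      by have [_ _ ->] := Pv l.
    by have [_ -> _] := Pv l.
  exists (\sum_j w j *: x j).
    by apply: polytope_convex => // j; have [] := Px j.
  rewrite affine_comb //; apply: eq_bigr => j _.
  by have [_ <-] := Px j.
Qed.

Theorem theorem1p2 (R : realType) (n d : nat) (V : seq 'rV[R]_n) :
  is_lattice_list V -> full_dim V ->
  has_degree (polytope V) d -> (1 <= d)%N ->
  exists q : nat, (2 * q <= d ^ 2 + 19 * d - 4)%N /\
    cayley_decomposes q (polytope V).
Proof.
move=> Vlat Vfull degV d_gt0; have [V0 V_int] := Vlat.
set A := lift_mx V; set h := lift_height R n.
have Ah : A *m h = const_mx 1 by exact: lift_mx_height.
have A_int : A \is a mxOver Num.int by exact: lift_mx_int.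
have h_int : h \is a mxOver Num.int by exact: lift_height_int.
have codeg z : z \is a mxOver Num.int -> open_cone A z ->
    (1 + n)%:R <= d%:R + height h z by exact: codegree_lift.
have [g uM bary_le1] := max_minor (lift_mx_rank V0 Vfull).
rewrite -/A in uM bary_le1.
have [U0 [U0_nonint U0_card U0_good]] := no_bad_rows Ah A_int h_int uM codeg bary_le1.
have nonint_card : (#|nonintegral A g| < 4 * d)%N.
  have [L [Lcount _ _]] := degV.
  have [s [_ sP _]] := lattice_points_lift V0 Lcount.
  exact: (nonintegral_card Ah A_int h_int uM codeg sP).
(* Putting [i0] into [U] ensures [s <= n], and the simplex vertex with index [i0] then lies over the
   origin of the standard simplex. *)
pose M := rowsub g A; pose i0 : 'I_(1 + n) := ord0; pose U := i0 |: U0.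
(* At most [4d - 1] nonintegral coordinates, [3d] added ones, and [i0]. *)
have U_card : (#|U| <= 7 * d)%N.
  rewrite cardsU1; move: U0_card nonint_card (leq_b1 (i0 \notin U0)).
  by move: (#|U0|) (#|nonintegral A g|) (nat_of_bool _) => x y z; clear; lia.
pose s := #|~: U|; pose q := (n - s)%N.
have Us_card : (#|U| + s = 1 + n)%N by rewrite cardsC card_ord.
have U_gt0 : (0 < #|U|)%N by apply/card_gt0P; exists i0; rewrite setU11.
have nE : n = (q + s)%N by clear -Us_card U_gt0; rewrite /q; lia.
(* Here [q = #|U| - 1 <= 7d - 1], and [14d - 2 <= d^2 + 19d - 4] for [d >= 1]. *)
exists q; split; first by clear -nE Us_card U_card d_gt0; nia.
pose io (r : 'I_s) : 'I_(1 + n) := enum_val r.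
have ioU r : io r \notin U by have := enum_valP r; rewrite inE.
have ioU0 r : io r \notin U0.
  by have := ioU r; rewrite !inE negb_or => /andP[].
pose C1 : 'M[R]_(1 + n, s) := \matrix_(l, r) invmx M l (io r).
have C1_int : C1 \is a mxOver Num.int.
  apply/mxOverP => l r; rewrite mxE.
  have : io r \notin nonintegral A g by apply: contra (ioU0 r); apply/subsetP.
  by rewrite inE negbK => /forallP.
(* Lifted vertices have first coordinate 1, so the first row of [C1] acts as a translation. *)
pose C := dsubmx C1; pose c := usubmx C1.
have cE x r : (x *m C + c) 0 r = bary A g (lift_pt 1 x) (io r).
  rewrite /bary -/M /lift_pt -[invmx M]vsubmxK mul_row_col mxE addrC [RHS]mxE.
  congr (_ + _).
    rewrite [RHS]mxE big_ord1 !mxE mul1r.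
    by congr (invmx M (lshift n _) _); apply: val_inj.
  by rewrite !mxE; apply: eq_bigr => l _; rewrite !mxE.
have simplex_lift i : lift_pt 1 V`_(g i) = row i M.
  by rewrite -row_lift_mx /M row_rowsub.
have baryV i r : (V`_(g i) *m C + c) 0 r = (i == io r)%:R.
  by rewrite cE simplex_lift bary_row.
(* Edge vectors from the vertex with index [i0] form an integral left inverse of [C]. *)
pose D : 'M[R]_(s, n) := \matrix_r (V`_(g (io r)) - V`_(g i0)).
have VV i : V`_(g i) \in V by rewrite mem_nth.
have D_int : D \is a mxOver Num.int.
  by apply/mxOverP => r l; rewrite !mxE rpredB //; apply: V_int.
have DC : D *m C = 1%:M.
  apply/matrixP => r r'.
  have -> : (D *m C) r r' = (row r (D *m C)) 0 r' by rewrite [RHS]mxE.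
  rewrite row_mul rowK mulmxBl.
  have -> : V`_(g (io r)) *m C - V`_(g i0) *m C =
    V`_(g (io r)) *m C + c - (V`_(g i0) *m C + c).
    by rewrite opprD addrACA subrr addr0.
  rewrite [LHS]mxE [X in _ + X]mxE !baryV mxE (inj_eq enum_val_inj).
  have /negPf-> : i0 != io r' by apply: contraNneq (ioU r') => <-; rewrite setU11.
  by rewrite subr0.
have C_int : C \is a mxOver Num.int.
  by apply/mxOverP => l r; rewrite mxE (mxOverP C1_int).
have c_int : c \is a mxOver Num.int.
  by apply/mxOverP => l r; rewrite mxE (mxOverP C1_int).
have [B [B' [[B_int B'_int] BB' B'B BC]]] := unimodular_completion nE C_int D_int DC.
pose b : 'rV[R]_(q + s) := row_mx 0 c.
have b_int : b \is a mxOver Num.int.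
  apply/mxOverP => l r; rewrite mxE; case: split => r'.
    by rewrite mxE rpred0.
  exact: (mxOverP c_int).
have fE x r : (rsubmx (x *m B + b)) 0 r = (x *m C + c) 0 r.
  by rewrite linearD /= row_mxKr -mulmx_rsub BC.
apply: (cayley_of_simplex_map V_int B_int B'_int b_int BB' B'B).
  move=> v vV; have vj : (index v V < size V)%N by rewrite index_mem.
  pose j := Ordinal vj; have vE : lift_pt 1 v = row j A.
    by rewrite /A row_lift_mx nth_index.
  have := U0_good j; rewrite /bad_row negb_or => /andP[/existsPn nneg].
  rewrite -leNgt => sum_le1; set u := bary A g (row j A) in nneg sum_le1.
  have u_ge0 i : i \notin U0 -> 0 <= u i.
    by move=> iU0; have := nneg i; rewrite iU0 -leNgt.
  have u_int i : i \notin U0 -> u i \is a Num.int.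
    move=> iU0; rewrite /u bary_int ?int_mx_row //.
    by apply: contra iU0; apply/subsetP.
  have u_ge1 i : i \notin U0 -> u i != 0 -> 1 <= u i.
    move=> iU0 ui; have := norm_intr_ge1 (u_int i iU0) ui.
    by rewrite ger0_norm ?u_ge0.
  (* Nonnegative integers with sum at most 1: either all vanish, or one equals 1 and the rest
     vanish. *)
  have [/existsP[r ur]|/existsPn ur0] := boolP [exists r, u (io r) != 0].
    exists (lift ord0 r); apply/rowP => r'; rewrite fE cE vE -/u mxE /= /bump /=.
    rewrite add1n eqSS; move: sum_le1; rewrite (bigD1 (io r)) ?ioU0 //=.
    have ur1 := u_ge1 _ (ioU0 r) ur.
    have [->|r'r] := eqVneq r' r.
      rewrite eqxx; set S := \sum_(i | _) _ => le1.
      have : 0 <= S by apply: sumr_ge0 => i /andP[/u_ge0].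
      by move=> ?; apply/eqP; rewrite eq_le ur1 andbT; lra.
    rewrite (bigD1 (io r')) /=; last by rewrite ioU0 (inj_eq enum_val_inj).
    set S := \sum_(i | _) _ => le1.
    have : 0 <= S by apply: sumr_ge0 => i /andP[/andP[/u_ge0]].
    have := u_ge0 _ (ioU0 r') => ? ?.
    have -> : (r' == r :> nat) = false by apply/negbTE.
    by apply/eqP; rewrite eq_le u_ge0 // andbT; lra.
  exists ord0; apply/rowP => r; rewrite fE cE vE -/u mxE /=.
  by apply/eqP; rewrite -[_ == _]negbK.
move=> i; case: (unliftP ord0 i) => [r|] ->.
  exists V`_(g (io r)) => //; apply/rowP => r'; rewrite fE baryV mxE /= /bump /=.
  by rewrite (add1n r) eqSS (inj_eq enum_val_inj) eq_sym -val_eqE /=; case: (_ == _).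
exists V`_(g i0) => //; apply/rowP => r; rewrite fE baryV mxE /=.
by have /negPf-> : i0 != io r by apply: contraNneq (ioU r) => <-; rewrite setU11.
Qed.
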